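(* The class $\mathcal{A}:=(\mathcal{J}\cap\mathcal{K})\setminus(\mathcal{L}\cup\mathcal{D})$ is non-empty. Moreover, neither $\mathcal{A}\cap\mathcal{DK}_1$ nor $\mathcal{A}\setminus\mathcal{DK}_1$ is empty, and each of these two subclasses contains both a distribution that is weakly tail equivalent to some distribution in $\mathcal{S}$ and a distribution that is not weakly tail equivalent to any distribution in $\mathcal{S}$.
   Context: All distributions $F$ are probability distributions on $\mathbb{R}$ with unbounded support contained in $[0,\infty)$; $\overline F:=1-F$ denotes the tail of the distribution function $F$ (so $\overline F(x)>0$ for all $x$), and $F^{*2}$ the convolution of $F$ with itself. $\mathcal{K}$ (heavy-tailed): $F\in\mathcal{K}$ iff $\int_0^\infty e^{\alpha y}\,dF(y)=\infty$ for all $\alpha>0$. $\mathcal{J}$ (principle of a single big jump): let $(X_i)_{i\ge1}$ be i.i.d. with distribution $F$, and let $X_{n,k}$ be the $k$-th largest among $X_1,\dots,X_n$. Then $F\in\mathcal{J}$ iff for all $n\ge2$, $$\lim_{K\to\infty}\liminf_{x\to\infty}\mathbb{P}\Big(X_{n,1}>x-K\ \Big|\ \sum_{i=1}^nX_i>x\Big)=1 .$$ $\mathcal{L}$ (long-tailed): $F\in\mathcal{L}$ iff $\lim_{x\to\infty}\overline F(x-t)/\overline F(x)=1$ for every $t>0$. $\mathcal{D}$ (dominatedly varying): $F\in\mathcal{D}$ iff $\limsup_{x\to\infty}\overline F(x/2)/\overline F(x)<\infty$. $\mathcal{S}$ (subexponential): $F\in\mathcal{S}$ iff $\lim_{x\to\infty}\overline{F^{*2}}(x)/\overline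 F(x)=2$. $\mathcal{DK}_1$: $F\in\mathcal{DK}_1$ iff $\lim_{x\to\infty}x^{\delta}\overline F(x)=\infty$ for some $\delta>0$. Two distributions $F$ and $G$ are weakly tail equivalent iff $0<\liminf_{x\to\infty}\overline F(x)/\overline G(x)\le\limsup_{x\to\infty}\overline F(x)/\overline G(x)<\infty$. *)

(* Defs.v *)
From HB Require Import structures.
From mathcomp Require Import all_boot all_order all_algebra finmap.
From mathcomp Require Import all_classical all_reals all_analysis measurable_realfun.

Set Implicit Arguments.
Unset Strict Implicit.
Unset Printing Implicit Defensive.

Import Order.TTheory GRing.Theory Num.Theory.
Import numFieldNormedType.Exports.

Local Open Scope classical_set_scope.
Local Open Scope ring_scope.

Definition support (R : realType) (F : probability R R) : set R :=
  [set x | forall U : set R, open U -> U x -> (0 < F U)%E].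

(* The distributions under consideration; every class below is a set of
   these, so complements are relative to this collection. *)
Record udist (R : realType) := UDist {
  law :> probability R R;
  support_ge0 : support law `<=` `[0, +oo[%classic;
  support_unbounded : ~ has_ubound (support law) }.

Definition dfun (R : realType) (F : probability R R) (x : R) : R :=
  fine (F `]-oo, x]%classic).

Definition tail (R : realType) (F : probability R R) (x : R) : R :=
  1 - dfun F x.

Definition add_pair (R : realType) (z : R * R) : R := z.1 + z.2.

Lemma measurable_add_pair (R : realType) :
  measurable_fun [set: R * R] (@add_pair R).
Proof. by apply: measurable_funD; [exact: measurable_fst|exact: measurable_snd]. Qed.

HB.instance Definition _ (R : realType) :=
  isMeasurableFun.Build _ _ (R * R)%type R (@add_pair R)
    (@measurable_add_pair R).

Definition convolution (R : realType) (F G : probability R R) :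
    probability R R :=
  distribution (F \x G)%E (@add_pair R).

Definition cond_prob (d : measure_display) (T : measurableType d)
    (R : realType) (P : probability T R) (A B : set T) : R :=
  fine (P (A `&` B)) / fine (P B).

Definition mutually_independent (d : measure_display) (T : measurableType d)
    (R : realType) (P : probability T R) (X : nat -> {RV P >-> R}) : Prop :=
  forall (I : {fset nat}) (B : nat -> set R),
    (forall i, measurable (B i)) ->
    P (\bigcap_(i in [set` I]) (X i @^-1` B i)) =
    (\prod_(i <- I) P (X i @^-1` B i))%E.

(* [X 0], [X 1], ... stand for X_1, X_2, ... *)
Definition iid_with_law (d : measure_display) (T : measurableType d)
    (R : realType) (P : probability T R) (X : nat -> {RV P >-> R})
    (F : probability R R) : Prop :=
  mutually_independent X /\
  forall (i : nat) (B : set R), measurable B -> distribution P (X i) B = F B.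

(* The [k]-th largest (1 <= k <= n) among the first [n] variables. *)
Definition order_stat (T : Type) (R : realType) (X : nat -> T -> R)
    (n k : nat) (w : T) : R :=
  nth 0 (sort >=%R [seq X i w | i <- iota 0 n]) k.-1.

Definition class_J (R : realType) : set (udist R) := [set F : udist R |
  forall (d : measure_display) (T : measurableType d) (P : probability T R)
    (X : nat -> {RV P >-> R}), iid_with_law X F ->
  forall n : nat, (2 <= n)%N ->
    limf_einf (fun x : R =>
      (cond_prob P [set w | order_stat X n 1 w > x - K]
                   [set w | \sum_(i < n) X i w > x])%:E) (pinfty_nbhs R)
    @[K --> +oo%R] --> 1%E].
Arguments class_J : clear implicits.

Definition class_K (R : realType) : set (udist R) := [set F : udist R |
  forall alpha : R, 0 < alpha ->
    (\int[law F]_(y in `[0%R, +oo[) (expR (alpha * y))%:E = +oo)%E].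
Arguments class_K : clear implicits.

Definition class_L (R : realType) : set (udist R) := [set F : udist R |
  forall t : R, 0 < t -> tail F (x - t) / tail F x @[x --> +oo%R] --> (1 : R)].
Arguments class_L : clear implicits.

Definition class_D (R : realType) : set (udist R) := [set F : udist R |
  (limf_esup (fun x : R => (tail F (x / 2) / tail F x)%:E) (pinfty_nbhs R)
   < +oo)%E].
Arguments class_D : clear implicits.

Definition class_S (R : realType) : set (udist R) := [set F : udist R |
  tail (convolution F F) x / tail F x @[x --> +oo%R] --> (2 : R)].
Arguments class_S : clear implicits.

Definition class_DK1 (R : realType) : set (udist R) := [set F : udist R |
  exists2 delta : R, 0 < delta & x `^ delta * tail F x @[x --> +oo%R] --> +oo%R].
Arguments class_DK1 : clear implicits.

Definition weakly_tail_equivalent (R : realType) (F G : udist R) : Prop :=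
  let r := fun x : R => (tail F x / tail G x)%:E in
  [/\ (0 < limf_einf r (pinfty_nbhs R))%E,
      (limf_einf r (pinfty_nbhs R) <= limf_esup r (pinfty_nbhs R))%E &
      (limf_esup r (pinfty_nbhs R) < +oo)%E].

Definition class_A (R : realType) : set (udist R) :=
  (class_J R `&` class_K R) `\` (class_L R `|` class_D R).
Arguments class_A : clear implicits.

(* Main.v *)
From HB Require Import structures.
Require Import Defs.
From mathcomp Require Import all_boot all_order all_algebra finmap.
From mathcomp Require Import all_classical all_reals all_analysis measurable_realfun.
From mathcomp Require Import zify ring lra.

(** All the examples are laws of integer-valued variables X with tail
    P(X > n) = s n ^ 2, where s n = exp (- h n) for a height h : nat -> R.

    Single big jump.  Suppose that over a window of length j ending at n, with
    j at most about n / 2, the height gains at most h j / 2 + C.  For the root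
    s this reads s (n - j) ^ 2 * s j <= C * s n ^ 2.  As the atom at y is at
    most a constant times (s (y - 1) - s y) * s y, the sum of
    P(X = y) * P(X > N - y) over K < y <= N - K is at most a constant times
    s K * P(X > N): the part y <= N / 2 telescopes, and summation by parts
    brings the other part back to it [shifted_mass].  An induction on the
    number of summands turns this into
    P(S_n > N, all X_i <= N - K) <= e * P(X > N) for K large, uniformly in N
    [box_exceed_small], which is membership in J [lattice_class_J].  For two
    summands, together with P(X > n + 1) ~ P(X > n), the same bound gives
    membership in S [lattice_class_S].

    Heights.  Fix scales N_0 < N_1 < ... growing at least by the factor 8.
    Right after N_k the height gains the sum over i < k of
    min(1, (n - N_k) / M_{k,i}), where N_i <= M_{k,i} <= N_k.  If
    N_{c-1} <= j < N_c, such a window gains at most c + 2, because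
    M_{k,i} >= N_i, while h j >= (c - 1) (c - 2) / 2; so the growth condition
    holds for all these widths [staircase_height].  Rounding the height down
    to an integer makes the tail drop at least by the factor exp 2 at
    infinitely many single steps, so the law is not in L; the gain k between
    N_k and 2 N_k excludes D; and h n = o(n) gives K.

    The four cases come from two independent choices.
    - With M_{k,i} = N_k the slopes k / N_k tend to 0, so the height without
      rounding defines a law in S, whose tail is within a factor exp 2 of the
      rounded one [wide_floor_equiv_S].  With M_{k,i} = N_i the height gains
      at least a between N_k and N_k + N_a for every k >= a, so the ratios
      P(X > x - t) / P(X > x) have limits superior that are unbounded in t.
      A law weakly tail equivalent to one in S cannot do this, because the
      tail of a law in S eventually loses at most a factor 2 over a fixed
      distance [narrow_floor_not_equiv_S].
    - For N_k = 8 ^ (k + 1) the height is of order (log n) ^ 2 and the tail is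
      lighter than every power; for N_k = 8 ^ ((k + 1) ^ 2) it is at most
      (ln n) / 2 and the tail is at least 1 / n. *)

Set Implicit Arguments.
Unset Strict Implicit.
Unset Printing Implicit Defensive.
Import Order.TTheory GRing.Theory Num.Theory.
Import numFieldNormedType.Exports.
Local Open Scope classical_set_scope.
Local Open Scope ring_scope.

(** * Lattice tails with at most one big summand *)

Section RegularRoots.
Variable R : realFieldType.

(** The tail is the square of [s]: the square root [s j] is exactly what
    [root_shift] may lose while sums of the loss 1 / s y against the atoms
    still converge. *)
Record regular_root (s : nat -> R) : Prop := RegularRoot {
  root0 : s 0 = 1;
  root_gt0 : forall n, 0 < s n;
  root_noninc : forall m n, (m <= n)%N -> s n <= s m;
  root_vanish : forall e, 0 < e -> exists n, s n < e;
  root_shift : exists C, forall n j, (j.*2 <= n.+1)%N ->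
    s (n - j)%N ^+ 2 * s j <= C * s n ^+ 2 }.

(** The mass at [y] of the law with tail [s n ^ 2] on the naturals; the predecessor
    truncated at 0 gives [atom s 0 = 0]. *)
Definition atom (s : nat -> R) (y : nat) : R := s y.-1 ^+ 2 - s y ^+ 2.

(** The probability that [z + X_1 + ... + X_n > N] while all [X_i < M], for independent
    [X_i] with masses [atom s]. *)
Fixpoint box_exceed (s : nat -> R) (N M n z : nat) : R :=
  if n is n'.+1 then \sum_(0 <= y < M) atom s y * box_exceed s N M n' (z + y)
  else (N < z)%N%:R.

Lemma sum_by_parts (T U : nat -> R) k l : (k <= l)%N ->
  \sum_(k <= z < l) T z * (U z.+1 - U z) =
  T l * U l - T k * U k + \sum_(k <= z < l) (T z - T z.+1) * U z.+1.
Proof.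
elim: l => [|l IH].
  by rewrite leqn0 => /eqP ->; rewrite !big_geq// subrr addr0.
rewrite leq_eqVlt => /orP[/eqP ->|]; first by rewrite !big_geq// subrr addr0.
by move=> kl; rewrite !big_nat_recr//= IH//; ring.
Qed.

Lemma sum_reflect (F : nat -> R) N k l : (k <= l)%N -> (l <= N)%N ->
  \sum_(N - l <= y < N - k) F y = \sum_(k <= z < l) F (N - z.+1)%N.
Proof.
elim: l => [|l IH]; first by rewrite leqn0 => /eqP -> _; rewrite !big_geq.
rewrite leq_eqVlt => /orP[/eqP <- _|kl lN]; first by rewrite !big_geq.
rewrite big_nat_recr//= -IH; [|lia|lia].
rewrite big_ltn; last lia.
by rewrite addrC; congr (_ + _); have -> : (N - l.+1).+1 = (N - l)%N by lia.
Qed.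

Section FixedRoot.
Variable s : nat -> R.
Hypothesis hs : regular_root s.
Let T n := s n ^+ 2.

Let sge0 n : 0 <= s n. Proof. exact: ltW (root_gt0 hs n). Qed.
Let sle1 n : s n <= 1. Proof. by rewrite -(root0 hs); apply: root_noninc. Qed.

Lemma tail_gt0 n : 0 < s n ^+ 2.
Proof. by rewrite exprn_gt0// root_gt0. Qed.

Lemma tail_le1 n : s n ^+ 2 <= 1.
Proof. by rewrite expr_le1. Qed.

Lemma tail_noninc m n : (m <= n)%N -> s n ^+ 2 <= s m ^+ 2.
Proof. by move=> mn; rewrite ler_pXn2r ?nnegrE// root_noninc. Qed.

Lemma atom_ge0 y : 0 <= atom s y.
Proof. by rewrite subr_ge0 tail_noninc// leq_pred. Qed.

Lemma atom0 : atom s 0 = 0.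
Proof. by rewrite /atom subrr. Qed.

Lemma sum_atom a b : (a <= b)%N ->
  \sum_(a.+1 <= y < b.+1) atom s y = s a ^+ 2 - s b ^+ 2.
Proof.
move=> ab; rewrite big_add1/= -(opprB (s b ^+ 2)) -(telescope_sumr (fun n => s n ^+ 2))//.
by rewrite -sumrN; apply: eq_bigr => i _; rewrite /atom/= opprB.
Qed.

Lemma sum_atom_le1 M : \sum_(0 <= y < M) atom s y <= 1.
Proof.
case: M => [|M]; first by rewrite big_geq.
rewrite big_nat_recl// atom0 add0r -(big_add1 _ _ 0 M.+1 xpredT (atom s)) sum_atom//.
by have := tail_le1 0; have := tail_gt0 M; lra.
Qed.

(** [root_shift] with j = 1 bounds (s y / s (y + 1)) ^ 2 by some Q, and
    1 + Q exceeds the square root of Q. *)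
Lemma root_ratio : exists B, forall y, s y <= B * s y.+1.
Proof.
have [C hC] := root_shift hs; exists (1 + C / s 1) => y.
have s1 := root_gt0 hs 1; have sy := root_gt0 hs y.+1; have s0 := root_gt0 hs y.
have : s y ^+ 2 <= C / s 1 * s y.+1 ^+ 2.
  rewrite mulrAC ler_pdivlMr//; have := hC y.+1 1; rewrite subn1; exact.
move: (C / s 1) => Q h.
have Q0 : 0 <= Q.
  rewrite -(pmulr_lge0 _ (exprn_gt0 2 sy)); apply: le_trans h; exact: sqr_ge0.
rewrite leNgt; apply/negP => lt; have := ler_ltD h (ltr_pM _ _ lt lt).
by rewrite -expr2; nra.
Qed.

(** The heart of the criterion: P(K < X <= N - K, X + X' > N) is small compared with
    P(X > N), uniformly in N.  For y <= N / 2, [root_shift]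
    bounds P(X > N - y) by C * P(X > N) / s y, and atom y / s y is at most a
    multiple of s (y - 1) - s y, which telescopes.  The part y > N / 2 is
    the same sum seen from the other summand, up to the boundary term
    P(X > N / 2) ^ 2 of a summation by parts. *)
Lemma shifted_mass : exists2 D, 0 <= D & forall k N,
  \sum_(k <= y < N - k) atom s y.+1 * T (N - y.+1) <= D * s k * T N.
Proof.
have [C hC] := root_shift hs; have [B hB] := root_ratio.
have C0 : 0 <= C.
  have := hC 0 0 isT; rewrite (root0 hs); lra.
have B0 : 0 <= B.
  by have := hB 0; have := root_gt0 hs 1; rewrite (root0 hs); nra.
(* The part y <= (N + 1) / 2; reflection reduces the other part to it. *)
have low k l N : (k <= l)%N -> (l.*2 <= N.+1)%N ->
    \sum_(k <= y < l) atom s y.+1 * T (N - y.+1) <= (B + 1) * C * s k * T N.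
  move=> kl lN.
  apply: (@le_trans _ _ (\sum_(k <= y < l)
      (- ((B + 1) * C * T N)) * (s y.+1 - s y))).
    apply: ler_sum_nat => y /andP[ky yl].
    have := hC N y.+1 ltac:(lia); have := hB y; rewrite /atom /T/=.
    have := root_noninc hs (leqnSn y).
    have := root_gt0 hs y.+1; have := root_gt0 hs y.
    have := root_gt0 hs (N - y.+1); have := root_gt0 hs N.
    move: (s (N - y.+1)) (s N) (s y) (s y.+1) => u w a b w0 u0 a0 b0 ab aB h.
    rewrite subr_sqr.
    apply: (@le_trans _ _ ((a - b) * ((B + 1) * b) * u ^+ 2)).
      rewrite ler_wpM2r ?sqr_ge0// ler_wpM2l ?subr_ge0//; lra.
    have := ler_wpM2l (_ : 0 <= (a - b) * (B + 1)) h.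
    by rewrite mulr_ge0 ?subr_ge0 ?addr_ge0// => /(_ isT); nra.
  rewrite -mulr_sumr telescope_sumr//.
  have := sge0 l; have := sge0 k; have := tail_gt0 N.
  have : 0 <= (B + 1) * C by rewrite mulr_ge0 ?addr_ge0.
  rewrite /T; move: (_ * C) => E E0 t0 sk sl.
  have : 0 <= E * s N ^+ 2 * s l by rewrite !mulr_ge0// ltW.
  lra.
exists ((B + 1) * C *+ 2 + C); first by rewrite addr_ge0// mulrn_wge0// mulr_ge0// addr_ge0.
move=> k N; have Nl := odd_double_half N; set l := N./2 in Nl.
pose h := (N - l)%N; have lh : (l <= h <= l.+1)%N by rewrite /h; lia.
case: (leqP h k) => [hk|kh].
  rewrite big_geq; last lia.
  by rewrite mulr_ge0 ?mulr_ge0 ?addr_ge0// ?mulrn_wge0 ?mulr_ge0 ?addr_ge0// ltW// tail_gt0.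
rewrite (big_cat_nat (n := h))/=; [|lia|lia].
have h1 := low k h N ltac:(lia) ltac:(lia).
have h2 := low k l N ltac:(lia) ltac:(lia).
have -> : \sum_(h <= y < N - k) atom s y.+1 * T (N - y.+1) =
    \sum_(k <= z < l) T z * (T (N - z.+1) - T (N - z)).
  rewrite /h sum_reflect; [|lia|lia].
  rewrite big_nat [RHS]big_nat; apply: eq_bigr => z /andP[_ zl].
  rewrite /atom/= /T mulrC; congr (s _ ^+ 2 * (_ - s _ ^+ 2)); lia.
(* With z = N - y the atom of the upper part becomes a difference of tails. *)
rewrite (sum_by_parts T (fun z => T (N - z)%N)); last lia.
have h3 := hC N l ltac:(lia).
have h4 : T l * T (N - l) <= C * s k * T N.
  apply: (@le_trans _ _ (s l * (C * T N))).
    by rewrite /T expr2 -mulrA ler_wpM2l// mulrC.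
  rewrite [X in _ <= X]mulrAC [X in _ <= X]mulrC ler_wpM2r ?mulr_ge0// ?(ltW (tail_gt0 _))//.
  by apply: root_noninc => //; lia.
have h5 : 0 <= T k * T (N - k) by rewrite mulr_ge0// ltW// tail_gt0.
rewrite mulr2n !mulrDl; move: h1 h2 h4 h5; rewrite /atom/= -/(T _); lra.
Qed.

Lemma box_exceed_ge0 N M n z : 0 <= box_exceed s N M n z.
Proof.
elim: n z => [|n IH] z /=; first exact: ler0n.
by apply: sumr_ge0 => y _; rewrite mulr_ge0// atom_ge0.
Qed.

Lemma box_exceed_le1 N M n z : box_exceed s N M n z <= 1.
Proof.
elim: n z => [|n IH] z /=; first by case: (N < z)%N.
apply: le_trans (sum_atom_le1 M); apply: ler_sum => y _.
by rewrite ler_piMr// atom_ge0.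
Qed.

Lemma box_exceed_mono N M n z z' : (z <= z')%N ->
  box_exceed s N M n z <= box_exceed s N M n z'.
Proof.
elim: n z z' => [|n IH] z z' zz' /=; first by rewrite ler_nat; lia.
apply: ler_sum => y _; rewrite ler_wpM2l ?atom_ge0//; apply: IH; lia.
Qed.

(** Shifting the start and the level together; this re-reads a sum that has already
    gained [a] as one that must only exceed a level lower by [a]. *)
Lemma box_exceed_shift N M n z a :
  box_exceed s (N + a) M n (z + a) = box_exceed s N M n z.
Proof.
elim: n z => [|n IH] z /=; first by rewrite ltn_add2r.
by apply: eq_bigr => y _; rewrite addnAC IH.
Qed.

(** A fixed number of summands exceeds a level with probability of the order of one tail;
    the sums of [shifted_mass] from 0 are the induction step. *)
Lemma box_exceed_le_tail n : exists2 C, 0 <= C & forall N M z, (z <= N)%N ->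
  box_exceed s N M n z <= C * T (N - z).
Proof.
have [D D0 hD] := shifted_mass.
elim: n => [|n [C C0 IH]].
  by exists 0 => // N M z zN; rewrite /= ltnNge zN mul0r.
exists (C * D + 1) => [|N M z zN]; first by rewrite addr_ge0// mulr_ge0.
rewrite /=; set m := (N - z)%N.
have tN0 := tail_gt0.
apply: (@le_trans _ _ (\sum_(0 <= y < m.+1) atom s y * box_exceed s N M n (z + y)
    + \sum_(m.+1 <= y < (m + M).+1) atom s y * box_exceed s N M n (z + y))).
  rewrite -(big_cat_nat (n := m.+1))//=; [|lia].
  rewrite (big_cat_nat (n := M) (p := (m + M).+1))//=; [|lia].
  by rewrite lerDl; apply: sumr_ge0 => y _; rewrite mulr_ge0 ?atom_ge0 ?box_exceed_ge0.
rewrite mulrDl mul1r; apply: lerD; last first.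
  apply: (@le_trans _ _ (\sum_(m.+1 <= y < (m + M).+1) atom s y)).
    by apply: ler_sum => y _; rewrite ler_piMr ?atom_ge0 ?box_exceed_le1.
  rewrite sum_atom; last lia.
  by rewrite gerBl ltW// tail_gt0.
rewrite big_nat_recl// atom0 mul0r add0r.
apply: (@le_trans _ _ (C * \sum_(0 <= y < m) atom s y.+1 * T (m - y.+1))).
  rewrite mulr_sumr; apply: ler_sum_nat => y /andP[_ ym].
  rewrite mulrCA ler_wpM2l ?atom_ge0//.
  have -> : (m - y.+1 = N - (z + y.+1))%N by rewrite /m; lia.
  apply: IH; move: ym; rewrite /m; lia.
by rewrite -mulrA ler_wpM2l//; have := hD 0 m; rewrite subn0 (root0 hs) mulr1.
Qed.

(** Induction on the number of summands, splitting on the value y of one of them.  If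
    y <= k', the others exceed N - k' while staying below it by k - k', and
    the tail at N - k' is within a factor C / s k' of the tail at N.  If
    y > k', [box_exceed_le_tail] for the others and [shifted_mass] apply.  Hence
    k' is fixed first, so that s k' is small, and the threshold for k after it. *)
Lemma box_exceed_small n e : 0 < e -> exists k0, forall k N,
  (k0 <= k <= N)%N -> box_exceed s N (N - k).+1 n 0 <= e * T N.
Proof.
have [D D0 hD] := shifted_mass.
elim: n e => [|n IH] e e0.
  by exists 0%N => k N kN; rewrite /= mulr_ge0// ltW// tail_gt0.
have [C hC] := root_shift hs.
have C0 : 0 < C + 1.
  have := hC 0 0 isT; rewrite (root0 hs); lra.
have [A A0 hA] := box_exceed_le_tail n.
have AD : 0 < 2 * (A * D + 1) by rewrite mulr_gt0// ltr_wpDl// mulr_ge0.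
have [k' hk'] := root_vanish hs (divr_gt0 e0 AD).
have sk' := root_gt0 hs k'.
(* The factor s k' / (C + 1) offsets the change of level from N - k' to N. *)
have e'0 : 0 < e / 2 * (s k' / (C + 1)) by rewrite !mulr_gt0 ?invr_gt0.
have [k1 hk1] := IH _ e'0.
exists (k1 + k'.*2)%N => k N kN; rewrite /=.
have -> : (N - k).+1 = (N - k' - (k - k')).+1 by lia.
set M := (N - k' - (k - k')).+1.
rewrite (big_cat_nat (n := minn k'.+1 M))//=; [|exact: geq_minr].
rewrite [X in _ <= X * _]splitr mulrDl; apply: lerD.
  apply: (@le_trans _ _ (\sum_(0 <= y < minn k'.+1 M) atom s y * (e / 2 * T N))).
    apply: ler_sum_nat => y /andP[_ /leq_trans/(_ (geq_minl _ _)) yk]; rewrite ler_wpM2l ?atom_ge0// add0n.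
    rewrite ltnS in yk; apply: (le_trans (box_exceed_mono N M n yk)).
    have NE : N = (N - k' + k')%N by lia.
    rewrite {1}NE -{3}[k']add0n box_exceed_shift.
    apply: (le_trans (hk1 _ _ _)); first lia.
    rewrite -mulrA ler_wpM2l ?divr_ge0 ?(ltW e0)// mulrAC ler_pdivrMr//.
    have := hC N k' ltac:(lia); have := tail_gt0 N; rewrite /T.
    by rewrite (mulrC (s k')); lra.
  rewrite -mulr_suml ler_piMl ?sum_atom_le1// mulr_ge0 ?(ltW (tail_gt0 _))//.
  by rewrite ltW// divr_gt0.
case: (leqP k'.+1 M) => [kM|_]; last first.
  by rewrite big_geq// mulr_ge0 ?(ltW (tail_gt0 _))// ltW// divr_gt0.
rewrite big_add1/=.
apply: (@le_trans _ _ (A * \sum_(k' <= y < N - k') atom s y.+1 * T (N - y.+1))).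
  rewrite mulr_sumr (big_cat_nat (n := (N - k' - (k - k'))%N) (p := (N - k')%N))/=; [|lia|lia].
  rewrite ler_wpDr//.
    by apply: sumr_ge0 => y _; rewrite !mulr_ge0 ?atom_ge0 ?(ltW (tail_gt0 _)).
  apply: ler_sum_nat => y yk; rewrite mulrCA ler_wpM2l ?atom_ge0// add0n.
  apply: hA; lia.
apply: (le_trans (ler_wpM2l A0 (hD _ _))); rewrite mulrA ler_wpM2r ?(ltW (tail_gt0 _))//.
move: hk'; rewrite ltr_pdivlMr// => hk'; rewrite ler_pdivlMr//.
have : A * (D * s k') = A * D * s k' by rewrite mulrA.
by lra.
Qed.

End FixedRoot.
End RegularRoots.

(** * Heights and staircases *)

Section Heights.
Variable R : realType.

(** The logarithmic form of [regular_root]: [u = - ln s]. *)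
Record height (u : nat -> R) : Prop := Height {
  height0 : u 0 = 0;
  height_mono : forall m n, (m <= n)%N -> u m <= u n;
  height_unbounded : forall A, exists n, A < u n;
  height_shift : exists C, forall n j, (j.*2 <= n.+1)%N ->
    u n <= u (n - j)%N + u j / 2 + C }.

Definition exp_decay (u : nat -> R) (n : nat) : R := expR (- u n).

Lemma exp_decay_sqr u n : exp_decay u n ^+ 2 = expR (- (2 * u n)).
Proof. by rewrite -expRM_natl; congr expR; rewrite mulrN mulr_natl. Qed.

Lemma exp_decay_regular u : height u -> regular_root (exp_decay u).
Proof.
case=> u0 um uu [C uC]; split => [|n|m n mn|e e0|].
- by rewrite /exp_decay u0 oppr0 expR0.
- exact: expR_gt0.
- by rewrite ler_expR lerN2 um.
- have [n hn] := uu (- ln e); exists n.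
  by rewrite /exp_decay -[ltRHS]lnK ?posrE// ltr_expR; lra.
- exists (expR (2 * C)) => n j jn; rewrite !exp_decay_sqr -!expRD ler_expR.
  by have := uC n j jn; lra.
Qed.

(** Rounding changes each height by at most 1, which the constant in [height_shift]
    absorbs. *)
Lemma truncn_height u : height u -> height (fun n => (Num.truncn (u n))%:R).
Proof.
case=> u0 um uu [C uC].
have ug n : 0 <= u n by rewrite -u0 um.
have lo n : (Num.truncn (u n))%:R <= u n by rewrite truncn_le.
have hi n : u n < (Num.truncn (u n))%:R + 1.
  by rewrite natr1 truncnS_gt.
split => [|m n mn|A|].
- by rewrite u0 truncn0.
- by rewrite ler_nat le_truncn// um.
- by have [n hn] := uu (A + 1); exists n; have := hi n; lra.
- exists (C + 2) => n j /uC; have := lo n; have := hi (n - j)%N; have := hi j; lra.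
Qed.

End Heights.

Section Staircases.
Variable R : realType.
Variables (N : nat -> nat) (M : nat -> nat -> nat).

(** The lower bound on the widths makes clusters gain slowly (the growth condition of
    [height]); the upper bound completes cluster [k] by [2 * N k]. *)
Record scales : Prop := Scales {
  scale0 : (0 < N 0)%N;
  scaleS : forall k, (8 * N k <= N k.+1)%N;
  scale_width : forall k i, (i < k)%N -> (N i <= M k i <= N k)%N }.

Definition ramp (a y : nat) : R := Num.min 1 (y%:R / a%:R).

Definition cluster (k y : nat) : R := \sum_(0 <= i < k) ramp (M k i) y.

Definition staircase (n : nat) : R := \sum_(0 <= k < n) cluster k (n - N k).

Lemma ramp_ge0 a y : 0 <= ramp a y.
Proof. by rewrite /ramp le_min ler01 divr_ge0. Qed.

Lemma ramp_le1 a y : ramp a y <= 1.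
Proof. by rewrite /ramp ge_min lexx. Qed.

Lemma ramp_le a y : ramp a y <= y%:R / a%:R.
Proof. by rewrite /ramp ge_min lexx orbT. Qed.

Lemma ramp0 a : ramp a 0 = 0.
Proof. by rewrite /ramp mul0r; apply/min_idPr. Qed.

Lemma ramp_mono a y z : (y <= z)%N -> ramp a y <= ramp a z.
Proof.
move=> yz; rewrite /ramp le_min !ge_min lexx/=; apply/orP; right.
by rewrite ler_wpM2r ?invr_ge0// ler_nat.
Qed.

Lemma ramp_anti a b y : (0 < a)%N -> (a <= b)%N -> ramp b y <= ramp a y.
Proof.
move=> a0 ab; rewrite /ramp le_min !ge_min lexx/=; apply/orP; right.
by rewrite ler_wpM2l// lef_pV2 ?posrE ?ltr0n ?ler_nat//; lia.
Qed.

Lemma ramp_full a y : (0 < a)%N -> (a <= y)%N -> ramp a y = 1.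
Proof.
move=> a0 ay; rewrite /ramp; apply/min_idPl.
by rewrite ler_pdivlMr ?ltr0n// mul1r ler_nat.
Qed.

Lemma ramp_subadd a y j : ramp a (y + j) <= ramp a y + ramp a j.
Proof.
have y0 : 0 <= y%:R / a%:R :> R by rewrite divr_ge0.
have j0 : 0 <= j%:R / a%:R :> R by rewrite divr_ge0.
rewrite /ramp natrD mulrDl; move: (y%:R / _) (j%:R / _) y0 j0 => p q p0 q0.
by rewrite !minEle; case: ifP; case: ifP; case: ifP; lra.
Qed.

Lemma sum_ones k : \sum_(0 <= i < k) 1 = k%:R :> R.
Proof. by rewrite sumr_const_nat subn0. Qed.

Lemma sum_split_at (F : nat -> R) m p : (m < p)%N ->
  \sum_(0 <= k < p) F k =
  \sum_(0 <= k < m) F k + (F m + \sum_(m.+1 <= k < p) F k).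
Proof. by move=> mp; rewrite (big_cat_nat (n := m)) ?(ltnW mp)//= (big_ltn mp). Qed.

Hypothesis hN : scales.

Lemma scale_gt0 k : (0 < N k)%N.
Proof. by elim: k => [|k IH]; [exact: scale0|have := scaleS hN k; lia]. Qed.

Lemma scale_mono k l : (k <= l)%N -> (N k <= N l)%N.
Proof.
elim: l => [|l IH]; first by rewrite leqn0 => /eqP ->.
rewrite leq_eqVlt => /orP[/eqP -> //|/IH]; have := scaleS hN l; lia.
Qed.

Lemma scale_lt k l : (k < l)%N -> (8 * N k <= N l)%N.
Proof. by move=> /scale_mono; apply: leq_trans; exact: scaleS. Qed.

Lemma ltn_scale k : (k < N k)%N.
Proof. by elim: k => [|k IH]; [exact: scale0|have := scaleS hN k; lia]. Qed.

Lemma scale_index n : exists2 m, (n < N m)%N & forall k, (k < m)%N -> (N k <= n)%N.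
Proof.
have ex : exists m, (n < N m)%N by exists n; exact: ltn_scale.
exists (ex_minn ex); case: ex_minnP => // m hm min k km.
by rewrite leqNgt; apply/negP => /min; lia.
Qed.

Lemma cluster_ge0 k y : 0 <= cluster k y.
Proof. by apply: sumr_ge0 => i _; exact: ramp_ge0. Qed.

Lemma cluster0 k : cluster k 0 = 0.
Proof. by apply: big1 => i _; exact: ramp0. Qed.

Lemma cluster_mono k y z : (y <= z)%N -> cluster k y <= cluster k z.
Proof. by move=> yz; apply: ler_sum => i _; exact: ramp_mono. Qed.

Lemma cluster_le k y : cluster k y <= k%:R.
Proof.
rewrite -sum_ones.
by apply: ler_sum => i _; exact: ramp_le1.
Qed.

Lemma cluster_full k y : (N k <= y)%N -> cluster k y = k%:R.
Proof.
move=> ky; rewrite -sum_ones /cluster big_nat [RHS]big_nat.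
apply: eq_bigr => i /andP[_ ik]; have := scale_width hN ik.
have := scale_gt0 i => *; rewrite ramp_full//; lia.
Qed.

(** The first [c] ramps contribute at most 1 each; the others have slopes 1 / N i that
    decrease geometrically, and the sum of j / N i is at most 2 as j < N c. *)
Lemma ramp_scales_sum k c j : (j < N c)%N ->
  \sum_(0 <= i < k) ramp (N i) j <= c%:R + 2.
Proof.
move=> jc; have jcR : j%:R / (N c)%:R <= 1 :> R.
  by rewrite ler_pdivrMr ?ltr0n ?scale_gt0// mul1r ler_nat ltnW.
have base l : \sum_(0 <= i < l) ramp (N i) j <= l%:R.
  rewrite -sum_ones.
  by apply: ler_sum => i _; exact: ramp_le1.
case: (leqP k c) => [kc|/ltnW].
  by apply: (le_trans (base k)); move: kc; rewrite -(ler_nat R); lra.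
have dgt0 l : 0 <= j%:R / (N l)%:R :> R by rewrite divr_ge0.
suff : (c <= k)%N -> \sum_(0 <= i < k) ramp (N i) j <= c%:R + 2 - 2 * (j%:R / (N k)%:R).
  by move=> h /h; have := dgt0 k; lra.
elim: k => [|k IH].
  by rewrite leqn0 => /eqP c0; move: jcR; rewrite c0 big_geq// => h; lra.
rewrite leq_eqVlt => /orP[/eqP <-|/IH {}IH].
  by have := base c; lra.
rewrite big_nat_recr//=.
have := ramp_le (N k) j.
have : 2 * (j%:R / (N k.+1)%:R) <= j%:R / (N k)%:R :> R.
  rewrite mulrCA ler_wpM2l// ler_pdivrMr ?ltr0n ?scale_gt0//.
  rewrite mulrC ler_pdivlMr ?ltr0n ?scale_gt0// -natrM ler_nat.
  by have := scaleS hN k; lia.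
by lra.
Qed.
(** Each ramp is concave and vanishes at 0, hence subadditive. *)
Lemma cluster_increment k c y j : (j < N c)%N ->
  cluster k (y + j) <= cluster k y + c%:R + 2.
Proof.
move=> jc; apply: (@le_trans _ _ (cluster k y + cluster k j)).
  by rewrite -big_split/=; apply: ler_sum => i _; exact: ramp_subadd.
rewrite -addrA lerD2l; apply: le_trans (ramp_scales_sum k jc).
apply: ler_sum_nat => i /andP[_ ik]; apply: ramp_anti (scale_gt0 i) _.
by have := scale_width hN ik; lia.
Qed.

Lemma staircaseE n m : (n <= m)%N ->
  staircase n = \sum_(0 <= k < m) cluster k (n - N k).
Proof.
move=> nm; rewrite /staircase (big_cat_nat (n := n) (p := m))//=.
rewrite [X in _ = _ + X]big_nat [X in _ = _ + X]big1 ?addr0// => k /andP[nk _].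
have -> : (n - N k = 0)%N by have := ltn_scale k; lia.
exact: cluster0.
Qed.

Lemma staircase_mono m n : (m <= n)%N -> staircase m <= staircase n.
Proof.
move=> mn; rewrite (staircaseE mn); apply: ler_sum => k _.
by apply: cluster_mono; lia.
Qed.

Lemma staircase0 : staircase 0 = 0.
Proof. by rewrite /staircase big_geq. Qed.

Lemma sum_nat_ltn c : \sum_(0 <= k < c) k%:R = c%:R * (c%:R - 1) / 2 :> R.
Proof.
elim: c => [|c IH]; first by rewrite big_geq// mul0r mul0r.
by rewrite big_nat_recr//= IH -natr1; field.
Qed.

Lemma staircase_ge c n : (N c <= n)%N ->
  c%:R * (c%:R - 1) / 2 <= staircase n.
Proof.
move=> cn; have cn' : (c <= n)%N by have := ltn_scale c; lia.
rewrite -sum_nat_ltn /staircase (big_cat_nat (n := c) (p := n))//= ler_wpDr//.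
  by apply: sumr_ge0 => k _; exact: cluster_ge0.
apply: ler_sum_nat => k /andP[_ kc]; rewrite cluster_full//.
by have := scale_lt kc; lia.
Qed.

Lemma staircase_le c n : (n < N c)%N -> staircase n <= c%:R * (c%:R - 1) / 2.
Proof.
move=> nc; rewrite -sum_nat_ltn (staircaseE (leq_maxr c n)).
rewrite (big_cat_nat (n := c))//=; last exact: leq_maxl.
rewrite [X in _ + X]big_nat [X in _ + X]big1 ?addr0 => [|k /andP[ck _]].
  by apply: ler_sum => k _; exact: cluster_le.
have -> : (n - N k = 0)%N by have := scale_mono ck; lia.
exact: cluster0.
Qed.

(** Between n' and n only cluster [m] moves: the later ones have not started, and the
    earlier ones are already complete at n'. *)
Lemma staircase_active n' n m : (n' <= n < N m.+1)%N ->
  (forall k, (k < m)%N -> (2 * N k <= n')%N) ->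
  staircase n - staircase n' <= cluster m (n - N m) - cluster m (n' - N m).
Proof.
move=> /andP[n'n nm] hm.
have mn : (m < maxn m.+1 n)%N by exact: leq_maxl.
rewrite (staircaseE (leq_maxr m.+1 n)) (staircaseE (leq_trans n'n (leq_maxr m.+1 n))).
rewrite !(sum_split_at _ mn).
have -> : \sum_(0 <= k < m) cluster k (n - N k) = \sum_(0 <= k < m) cluster k (n' - N k).
  rewrite big_nat [RHS]big_nat; apply: eq_bigr => k /andP[_ /hm km].
  by rewrite !cluster_full//; lia.
have -> : \sum_(m.+1 <= k < maxn m.+1 n) cluster k (n - N k) = 0.
  rewrite big_nat big1// => k /andP[mk _].
  have -> : (n - N k = 0)%N by have := scale_mono mk; lia.
  exact: cluster0.
have : 0 <= \sum_(m.+1 <= k < maxn m.+1 n) cluster k (n' - N k).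
  by apply: sumr_ge0 => k _; exact: cluster_ge0.
lra.
Qed.

Lemma staircase_increment n j c : (j.*2 <= n.+1)%N -> (j < N c)%N ->
  staircase n <= staircase (n - j) + c%:R + 2.
Proof.
move=> jn jc; have [[|m] nm hm] := scale_index n.
  have := staircase_le nm; have := staircase_mono (leq0n (n - j)).
  by rewrite staircase0 mul0r mul0r; have : 0 <= c%:R :> R by []; lra.
have := @staircase_active (n - j) n m ltac:(lia).
have full k : (k < m)%N -> (2 * N k <= n - j)%N.
  move=> km; have := hm m (ltnSn m); have := scale_lt km; have := scale_gt0 k; lia.
move=> /(_ full); have : cluster m (n - N m) <= cluster m (n - j - N m) + c%:R + 2.
  apply: le_trans (cluster_increment m (n - j - N m) jc).
  by apply: cluster_mono; lia.
lra.
Qed.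

(** With N (c - 1) <= j < N c, a window of length j gains at most c + 2, while its initial
    window has already gained (c - 1) (c - 2) / 2. *)
Lemma staircase_height : height staircase.
Proof.
split; [exact: staircase0|exact: staircase_mono| |].
  move=> A; have := truncnS_gt (2 * A); move: (Num.truncn _) => q.
  rewrite -[q.+1]addn1 natrD => Aq; exists (N q.+3); have := staircase_ge (leqnn (N q.+3)).
  have -> : q.+3%:R = q%:R + 3 :> R by rewrite -addn3 natrD.
  have : 0 <= q%:R :> R by [].
  by move: (q%:R : R) Aq => t At t0; nra.
(* 7 exceeds c + 2 - (c - 1) (c - 2) / 4 for all c, and the gain 2 when c = 0. *)
exists 7 => n j jn; have [c jc hc] := scale_index j.
have := staircase_increment jn jc.
case: c jc hc => [|c] jc hc.
  by have := staircase_mono (leq0n j); rewrite staircase0; lra.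
have := staircase_ge (hc c (ltnSn c)); rewrite -[c.+1]addn1 natrD.
by move: (c%:R : R) (staircase n) (staircase _) (staircase j) => x p q r; have := sqr_ge0 (x - 3); nra.
Qed.

Lemma staircase_cluster k y :
  staircase (N k) + cluster k y <= staircase (N k + y).
Proof.
have kN : (k < N k + y)%N by have := ltn_scale k; lia.
rewrite (staircaseE (leq_addr y (N k))) /staircase.
rewrite !(sum_split_at _ kN) subnn cluster0 add0r -addrA.
apply: lerD; first by apply: ler_sum => i _; apply: cluster_mono; lia.
rewrite addrC; apply: lerD; first by apply: cluster_mono; lia.
by apply: ler_sum => i _; apply: cluster_mono; lia.
Qed.

Lemma staircase_block k : staircase (N k) + k%:R <= staircase (2 * N k).
Proof. by rewrite mul2n -addnn -[X in _ + X <= _](cluster_full (leqnn _)) staircase_cluster. Qed.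

(** From 8 = 2 ^ 3; it makes k ^ 2 = o(N k). *)
Lemma cube_le_scale k : (k.+1 ^ 3 <= N k)%N.
Proof.
elim: k => [|k IH]; first exact: scale0.
apply: leq_trans (scaleS hN k); apply: leq_trans (leq_mul (leqnn 8) IH).
by rewrite -[8%N]/(2 ^ 3)%N -expnMn leq_exp2r//; lia.
Qed.

(** At n = N k the height is at most k (k + 1) / 2, while n >= (k + 1) ^ 3. *)
Lemma staircase_sublinear (a A : R) : 0 < a -> exists n, A < a * n%:R - 2 * staircase n.
Proof.
move=> a0; pose k := maxn (Num.truncn (2 / a)) (Num.truncn A).
exists (N k).
have h1 : 2 < a * k.+1%:R.
  rewrite mulrC -ltr_pdivrMr//; apply: lt_le_trans (truncnS_gt _) _.
  by rewrite ler_nat ltnS leq_maxl.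
have h2 : A < k.+1%:R.
  apply: lt_le_trans (truncnS_gt A) _.
  by rewrite ler_nat ltnS leq_maxr.
have h3 : a * k.+1%:R ^+ 3 <= a * (N k)%:R.
  by rewrite ler_wpM2l ?(ltW a0)// -natrX ler_nat cube_le_scale.
have := @staircase_le k.+1 (N k) ltac:(have := scaleS hN k; have := scale_gt0 k; lia).
move: h1 h2 h3; have : 1 <= k.+1%:R :> R by rewrite ler1n.
move: (k.+1%:R : R) (staircase _) => x S; rewrite exprS mulrA => x1 h1 h2 h3 h4.
have : 2 * x ^+ 2 <= a * x * x ^+ 2 by rewrite ler_wpM2r ?sqr_ge0// ltW.
nra.
Qed.

End Staircases.

Section Examples.
Variable R : realType.

Lemma wide_scales N : (0 < N 0)%N -> (forall k, (8 * N k <= N k.+1)%N) ->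
  scales N (fun k i => N k).
Proof.
move=> N0 NS; split=> // k i ik; rewrite leqnn andbT.
elim: k ik => // k IH; rewrite ltnS leq_eqVlt => /orP[/eqP ->|/IH];
  have := NS k; lia.
Qed.

Lemma narrow_scales N : (0 < N 0)%N -> (forall k, (8 * N k <= N k.+1)%N) ->
  scales N (fun k i => N i).
Proof.
move=> N0 NS; have h := wide_scales N0 NS; split=> // k i ik.
by rewrite leqnn/=; have /andP[] := scale_width h ik.
Qed.

(** A step inside cluster [m] gains at most m / N m, which tends to 0. *)
Lemma wide_staircase_step N (e : R) : scales N (fun k i => N k) -> 0 < e ->
  exists n0, forall n, (n0 <= n)%N ->
    staircase R N (fun k i => N k) n.+1 <= staircase R N (fun k i => N k) n + e.
Proof.
move=> hN e0; pose K := Num.truncn e^-1; exists (N K) => n Kn.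
have [m nm hm] := scale_index hN n.+1.
have Km : (K < m)%N.
  rewrite ltnNge; apply/negP => /(scale_mono hN); lia.
case: m nm hm Km => // m nm hm; rewrite ltnS => Km.
have := @staircase_active R N _ hN n n.+1 m ltac:(lia).
have full k : (k < m)%N -> (2 * N k <= n)%N.
  move=> km; have := hm m (ltnSn m); have := scale_lt hN km; have := scale_gt0 hN k; lia.
move=> /(_ full).
have Nm : 0 < (N m)%:R :> R by rewrite ltr0n (scale_gt0 hN).
have : cluster R (fun k i => N k) m (n.+1 - N m) <=
       cluster R (fun k i => N k) m (n - N m) + m%:R / (N m)%:R.
  apply: (@le_trans _ _ (cluster R (fun k i => N k) m (n - N m + 1))).
    by apply: cluster_mono; lia.
  have -> : m%:R / (N m)%:R = \sum_(0 <= i < m) (N m)%:R^-1 :> R.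
    by rewrite sumr_const_nat subn0 mulr_natl.
  rewrite -big_split/=; apply: ler_sum => i _.
  apply: le_trans (ramp_subadd _ _ _ _) _; rewrite lerD2l.
  by apply: le_trans (ramp_le _ _ _) _; rewrite div1r.
have : m%:R / (N m)%:R < e.
  rewrite ltr_pdivrMr//.
  have Ke : e^-1 < m.+1%:R.
    by apply: lt_le_trans (truncnS_gt _) _; rewrite ler_nat ltnS.
  have Nm3 : m.+1%:R ^+ 3 <= (N m)%:R :> R by rewrite -natrX ler_nat (cube_le_scale hN).
  have : 1 < e * m.+1%:R by rewrite mulrC -ltr_pdivrMr// div1r.
  have : e * m.+1%:R ^+ 3 <= e * (N m)%:R by rewrite ler_wpM2l// ltW.
  have : 0 <= m%:R :> R by [].
  rewrite -natr1; move: (m%:R : R) => x x0; rewrite exprS mulrA => h1 h2.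
  have : 1 * (x + 1) ^+ 2 <= e * (x + 1) * (x + 1) ^+ 2 by rewrite ler_wpM2r ?sqr_ge0// ltW.
  nra.
lra.
Qed.

(** The ramps i < a of cluster [k], of widths N i <= N a, are complete at N k + N a. *)
Lemma narrow_staircase_drop N a k : scales N (fun k i => N i) -> (a <= k)%N ->
  staircase R N (fun k i => N i) (N k) + a%:R <=
  staircase R N (fun k i => N i) (N k + N a).
Proof.
move=> hN ak; apply: le_trans (staircase_cluster _ hN k (N a)).
rewrite lerD2l /cluster (big_cat_nat (n := a) (p := k))//= ler_wpDr//.
  by apply: sumr_ge0 => i _; exact: ramp_ge0.
rewrite -(sum_ones R a); apply: ler_sum_nat => i /andP[_ ia].
by rewrite ramp_full ?(scale_gt0 hN)// (scale_mono hN)// ltnW.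
Qed.

(** A quadratic in k with negative leading coefficient is bounded above. *)
Lemma geometric_staircase_light M (d : R) : scales (fun k => 8 ^ k.+1)%N M ->
  exists B, forall k,
    d * ln (8 ^ k.+1)%:R - 2 * staircase R (fun k => 8 ^ k.+1)%N M (8 ^ k.+1)%N <= B.
Proof.
move=> hN; pose L : R := d * ln 8; exists ((L + 1) ^+ 2 / 4 + L) => k.
have -> : d * ln (8 ^ k.+1)%:R = L * (k%:R + 1).
  by rewrite natrX lnXn// -(mulr_natr (ln _)) mulrA -[k.+1]addn1 natrD.
have := staircase_ge R hN (leqnn (8 ^ k.+1)%N).
move: (k%:R : R) (staircase _ _ _ _) => x S.
by have := sqr_ge0 (x - (L + 1) / 2); nra.
Qed.

(** If N (c - 1) <= n < N c, the height is at most c (c - 1) / 2, while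
    n >= 8 ^ (c ^ 2) >= exp (c ^ 2). *)
Lemma sparse_staircase_heavy M n : scales (fun k => 8 ^ (k.+1 ^ 2))%N M -> (0 < n)%N ->
  2 * staircase R (fun k => 8 ^ (k.+1 ^ 2))%N M n <= ln n%:R.
Proof.
move=> hN n0; have [c nc hc] := scale_index hN n.
have := staircase_le R hN nc; case: c nc hc => [|c] nc hc.
  by rewrite mul0r mul0r; have : 0 <= ln n%:R :> R by [rewrite ln_ge0// ler1n]; lra.
have : ((c.+1 ^ 2)%N)%:R <= ln n%:R :> R.
  rewrite -[leLHS]expRK ler_ln ?posrE ?expR_gt0 ?ltr0n//.
  apply: (@le_trans _ _ (8 ^ (c.+1 ^ 2))%:R); last by rewrite ler_nat hc.
  rewrite -[X in expR X]mulr1 expRM_natl natrX ler_pXn2r ?nnegrE ?expR_ge0//.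
  have h : 1 / 2 <= expR (- (1 / 2)) :> R.
    by apply: le_trans (expR_ge1Dx _); lra.
  have e1 : expR 1 * expR (- (1 / 2)) ^+ 2 = 1 :> R.
    by rewrite -expRM_natl -expRD -[RHS]expR0; congr expR; field.
  have : 0 <= expR 1 * ((expR (- (1 / 2)) - 1 / 2) * (expR (- (1 / 2)) + 1 / 2)) :> R.
    by rewrite !mulr_ge0 ?expR_ge0 ?subr_ge0 ?addr_ge0 ?expR_ge0//; lra.
  have -> : expR 1 * ((expR (- (1 / 2)) - 1 / 2) * (expR (- (1 / 2)) + 1 / 2)) =
    expR 1 * expR (- (1 / 2)) ^+ 2 - expR 1 / 4 :> R by field.
  by rewrite e1; lra.
rewrite natrX; have : 0 <= c.+1%:R :> R by [].
by move: (c.+1%:R : R) (staircase _ _ _ _) => x S; nra.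
Qed.

End Examples.

(** * Lattice laws and the event of no big summand *)

Section TailFacts.
Variable R : realType.

Lemma tailE (F : probability R R) x : F `]x, +oo[%classic = (tail F x)%:E.
Proof.
have -> : `]x, +oo[%classic = ~` `]-oo, x]%classic :> set R by rewrite setCitvl.
rewrite probability_setC// /tail /dfun -[X in (_ - X)%E]fineK ?fin_num_measure//.
Qed.

Lemma prob_le_ae d (T : measurableType d) (P : probability T R) (A B Z : set T) :
  measurable A -> measurable B -> measurable Z -> P Z = 0%E ->
  A `<=` B `|` Z -> (P A <= P B)%E.
Proof.
move=> mA mB mZ Z0 AB; rewrite -(measureU0 mB mZ Z0).
by apply: le_measure; rewrite ?inE//; exact: measurableU.
Qed.

Definition naturals : set R := range (fun n : nat => n%:R).

Lemma measurable_naturals : measurable naturals.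
Proof.
apply: countable_measurable; first by move=> t; exact: measurable_set1.
exact: card_image_le.
Qed.

(** For x < 0 the truncation is 0, and the tail is s 0 ^ 2 = 1 when [s] is regular. *)
Definition lattice_law (s : nat -> R) (F : probability R R) : Prop :=
  (forall x, tail F x = s (Num.truncn x) ^+ 2) /\ F (~` naturals) = 0%E.

Lemma truncn_lt_real (x : R) n : (x < n.+1%:R) = (Num.truncn x <= n)%N.
Proof. by rewrite real_truncn_le_nat// num_real. Qed.

Lemma root_cvg0 (s : nat -> R) : regular_root s -> s n ^+ 2 @[n --> \oo] --> 0.
Proof.
move=> hs; apply/cvgrPdist_lt => e e0; have [k sk] := root_vanish hs e0.
exists k => // n /= kn; rewrite sub0r normrN ger0_norm ?sqr_ge0//.
apply: le_lt_trans sk; apply: le_trans (root_noninc hs kn).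
have := tail_le1 hs n; have := root_gt0 hs n => s0 s1.
by rewrite expr2; apply: ler_piMr; [exact: ltW|rewrite -(root0 hs) root_noninc].
Qed.

Section LatticeConstruction.
Variable s : nat -> R.
Hypothesis hs : regular_root s.

Let q n : {nonneg R} := NngNum (atom_ge0 hs n.+1).

(** The atom at [n.+1] has mass [atom s n.+1]; 0 carries none because [s 0 = 1]. *)
Definition lattice_measure : set R -> \bar R :=
  mseries (fun n => mscale (q n) (@dirac _ R (n.+1%:R : R) R)) 0.

HB.instance Definition _ := Measure.on lattice_measure.

Let atom_series m : (\sum_(0 <= n <oo) ((atom s n.+1)%:E * (m <= n)%N%:R%:E) =
  (s m ^+ 2)%:E)%E.
Proof.
apply/cvg_lim => //; rewrite -[X in _ --> X]sube0.
have : ((s m ^+ 2)%:E - (s n ^+ 2)%:E)%E @[n --> \oo] --> ((s m ^+ 2)%:E - 0)%E.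
  apply: cvgeB => //; first exact: cvg_cst.
  by apply: cvg_EFin; [exact: nearW|exact: root_cvg0].
apply: cvg_trans; apply: near_eq_cvg; exists m => // n /= mn.
rewrite (big_cat_nat (n := m))//=.
rewrite big_nat big1 ?add0e => [|i /andP[_ im]]; last by rewrite leqNgt im mule0.
rewrite -EFinB -sum_atom// big_add1/= -sumEFin.
by apply: eq_big_nat => i /andP[mi _]; rewrite mi mule1.
Qed.

Let lattice_setT : lattice_measure setT = 1%E.
Proof.
rewrite /lattice_measure/= /mseries/= -[RHS]/(1%:E).
have <- : (s 0 ^+ 2)%:E = 1%:E :> \bar R by rewrite (root0 hs) expr1n.
rewrite -atom_series; apply: eq_eseriesr => n _.
by rewrite /mscale/= diracT.
Qed.

HB.instance Definition _ :=
  Measure_isProbability.Build _ _ R lattice_measure lattice_setT.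

Lemma exists_lattice_law : exists F : probability R R, lattice_law s F.
Proof.
exists (lattice_measure : probability R R); split => [x|].
  apply: EFin_inj; rewrite -tailE.
  rewrite /= /lattice_measure /mseries/= -atom_series.
  apply: eq_eseriesr => n _; rewrite /mscale/= diracE; congr (_ * _%:R%:E)%E.
  by rewrite mem_setE in_itv/= andbT truncn_lt_real.
rewrite /= /lattice_measure /mseries/= eseries0// => n _ _.
rewrite /mscale/= diracE memNset ?mule0//=.
by apply; exists n.+1.
Qed.

End LatticeConstruction.
Section LatticeFacts.
Variable s : nat -> R.
Hypothesis hs : regular_root s.
Variable F : probability R R.
Hypothesis hF : lattice_law s F.

(** The tails at y - 1 and y differ by at least the mass of the singleton. *)
Lemma lattice_atom (y : nat) : (F [set y%:R] <= (atom s y)%:E)%E.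
Proof.
have [hT _] := hF.
have : (F ([set y%:R] `|` `]y%:R, +oo[%classic) <= F `](y%:R - 1)%R, +oo[%classic)%E.
  apply: le_measure; rewrite ?inE//; first exact: measurableU.
  by move=> z /=; rewrite !in_itv/= !andbT => -[->|]; lra.
rewrite measureU//; last first.
  by apply/seteqP; split => // z /= [->]; rewrite in_itv/= ltxx.
rewrite /= !tailE !hT natrK.
have -> : Num.truncn (y%:R - 1 : R) = y.-1.
  case: y => [|y]; last by rewrite -(natr1 y) addrK natrK.
  by apply/eqP; rewrite -leqn0 -truncn_lt_real; lra.
by rewrite -leeBrDr.
Qed.

End LatticeFacts.

Section BoxBound.
Variable s : nat -> R.
Hypothesis hs : regular_root s.
Context d (T : measurableType d) (P : probability T R) (X : nat -> T -> R).
Hypothesis mX : forall i, measurable_fun setT (X i).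

Lemma measurable_sum_gt n x :
  measurable ((fun w => \sum_(i < n) X i w) @^-1` `]x, +oo[%classic).
Proof.
have mS : measurable_fun setT (fun w => \sum_(i < n) X i w).
  by apply: measurable_sum => i; exact: mX.
by rewrite -[X in measurable X]setTI; apply: mS.
Qed.

Definition cylinder (ys : seq nat) : set T :=
  \bigcap_(i in `I_(size ys)) X i @^-1` [set (nth 0%N ys i)%:R].

Lemma measurable_cylinder ys : measurable (cylinder ys).
Proof.
apply: bigcap_measurableType => i _; rewrite -[X in measurable X]setTI.
by apply: mX => //; exact: measurable_set1.
Qed.

Definition box_event (N M n : nat) : set T :=
  [set w | (forall i, (i < n)%N -> exists2 y, (y < M)%N & X i w = y%:R) /\
           N%:R < \sum_(i < n) X i w].

Lemma measurable_box_event N M n : measurable (box_event N M n).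
Proof.
have -> : box_event N M n =
  (\bigcap_(i in `I_n) \bigcup_(y in `I_M) X i @^-1` [set y%:R]) `&`
  (fun w => \sum_(i < n) X i w) @^-1` `]N%:R, +oo[.
  by apply/seteqP; split => w /= [h1]; rewrite ?in_itv/= ?andbT => h2; split.
apply: measurableI; last exact: measurable_sum_gt.
apply: bigcap_measurableType => i _; apply: bigcup_measurable => y _.
by rewrite -[X in measurable X]setTI; apply: mX => //; exact: measurable_set1.
Qed.

Variable n : nat.
Hypothesis cylP : forall ys, (size ys <= n)%N ->
  (P (cylinder ys) <= (\prod_(y <- ys) atom s y)%:E)%E.

(** Induction on the number [r] of coordinates not yet prescribed; prescribing one more
    splits the event into [M] pieces.  As only an
    upper bound is claimed, subadditivity reduces it to the probabilities of
    cylinders. *)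
Lemma box_event_cylinder N M r ys : (size ys + r = n)%N ->
  (P (cylinder ys `&` box_event N M n) <=
   ((\prod_(y <- ys) atom s y) * box_exceed s N M r (sumn ys))%:E)%E.
Proof.
elim: r ys => [|r IH] ys szn.
  rewrite addn0 in szn; rewrite /=.
  case: ltnP => Ny.
    rewrite mulr1; apply: le_trans (cylP _); last by rewrite szn.
    apply: le_measure; rewrite ?inE; last exact: subIsetl.
      by apply: measurableI; [exact: measurable_cylinder|exact: measurable_box_event].
    exact: measurable_cylinder.
  rewrite mulr0 (_ : _ `&` _ = set0) ?measure0// -subset0 => w [cw [_ Nw]].
  move: Nw; apply/negP; rewrite -leNgt.
  have -> : \sum_(i < n) X i w = (sumn ys)%:R; last by rewrite ler_nat.
  rewrite sumnE (big_nth 0%N) big_mkord szn natr_sum.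
  by apply: eq_bigr => i _; apply: cw => /=; rewrite szn.
have sub : cylinder ys `&` box_event N M n `<=`
    \big[setU/set0]_(y < M) (cylinder (rcons ys y) `&` box_event N M n).
  move=> w [cw bw]; have [y yM Xy] := bw.1 (size ys) ltac:(lia).
  rewrite -(bigcup_mkord M (fun y => cylinder (rcons ys y) `&` box_event N M n)).
  exists y => //; split => // i /=.
  rewrite size_rcons nth_rcons ltnS leq_eqVlt => /orP[/eqP ->|ilt].
    by rewrite ltnn eqxx.
  by rewrite ilt; exact: cw.
have mE y : measurable (cylinder (rcons ys y) `&` box_event N M n).
  by apply: measurableI; [exact: measurable_cylinder|exact: measurable_box_event].
apply: (@le_trans _ _ (\sum_(y < M) P (cylinder (rcons ys y) `&` box_event N M n))%E).
  apply: le_trans (Boole_inequality P (A := fun y => cylinder (rcons ys y) `&` box_event N M n) _) => //.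
  apply: le_measure; rewrite ?inE//; last by apply: bigsetU_measurable.
  by apply: measurableI; [exact: measurable_cylinder|exact: measurable_box_event].
rewrite /= big_mkord mulr_sumr -sumEFin; apply: lee_sum => y _.
have := IH (rcons ys y) ltac:(rewrite size_rcons; lia).
by rewrite -cats1 big_cat big_seq1/= sumn_cat/= addn0 mulrA.
Qed.

Lemma box_event_le N M : (P (box_event N M n) <= (box_exceed s N M n 0)%:E)%E.
Proof.
have := @box_event_cylinder N M n [::] (add0n n).
rewrite big_nil mul1r /= (_ : cylinder [::] `&` _ = box_event N M n)//.
by apply/seteqP; split => [w []//|w bw]; split => // i.
Qed.

End BoxBound.

Section SingleBigJump.
Variable s : nat -> R.
Hypothesis hs : regular_root s.
Context d (T : measurableType d) (P : probability T R) (X : nat -> T -> R).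
Hypothesis mX : forall i, measurable_fun setT (X i).
Variable n : nat.
Hypothesis cylP : forall ys, (size ys <= n)%N ->
  (P (cylinder X ys) <= (\prod_(y <- ys) atom s y)%:E)%E.
Hypothesis natP : forall i, (i < n)%N -> P (X i @^-1` (~` naturals)) = 0%E.

Definition not_natural : set T := \bigcup_(i in `I_n) X i @^-1` (~` naturals).

Lemma measurable_preimage i A : measurable A -> measurable (X i @^-1` A).
Proof. by move=> mA; rewrite -[X in measurable X]setTI; exact: mX. Qed.

Lemma measurable_not_natural : measurable not_natural.
Proof.
apply: bigcup_measurable => i _; apply: measurable_preimage.
by apply: measurableC; exact: measurable_naturals.
Qed.

Lemma not_natural0 : P not_natural = 0%E.
Proof.
apply/negligibleP; first exact: measurable_not_natural.
rewrite /not_natural bigcup_mkcond; apply: negligible_bigcup => i.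
case: ifPn => [|_]; last exact: negligible_set0.
rewrite inE/= => ni; apply/negligibleP; last exact: natP.
by apply: measurable_preimage; apply: measurableC; exact: measurable_naturals.
Qed.

(** Outside the null event that some variable is not a natural number, the event is
    contained in a [box_event] for the integer parts of x and K. *)
Lemma no_big_jump_event (e : R) : 0 < e ->
  exists2 k0 : R, 0 < k0 & forall K x : R, k0 <= K -> K <= x ->
  (P [set w | (forall i, (i < n)%N -> (X i w <= x - K)%R) /\
              (x < \sum_(i < n) X i w)%R]
   <= (e * s (Num.truncn x) ^+ 2)%:E)%E.
Proof.
move=> e0; have [k0 hk0] := box_exceed_small hs n e0.
exists k0.+1%:R => // K x kK Kx.
have K0 : 0 <= K by apply: le_trans kK.
have x0 : 0 <= x by apply: le_trans Kx.
have kx : (k0 <= Num.truncn K <= Num.truncn x)%N.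
  rewrite le_truncn// andbT truncn_ge_nat//; apply: le_trans kK.
  by rewrite ler_nat.
have := hk0 _ _ kx; rewrite -lee_fin; apply: le_trans.
apply: le_trans (box_event_le mX cylP _ _).
apply: (prob_le_ae _ _ measurable_not_natural not_natural0).
- rewrite (_ : [set w | _] = (\bigcap_(i in `I_n) X i @^-1` `]-oo, x - K]%classic) `&`
     (fun w => \sum_(i < n) X i w) @^-1` `]x, +oo[%classic); last first.
    by apply/seteqP; split => w /= [h1]; rewrite ?in_itv/= ?andbT => h2; split.
  apply: measurableI; last exact: measurable_sum_gt.
  by apply: bigcap_measurableType => i _; exact: measurable_preimage.
- exact: measurable_box_event.
move=> w [h1 h2]; have [|nn] := pselect (not_natural w); first by right.
left; split; last by apply: le_lt_trans h2; rewrite truncn_le.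
move=> i ni; have [y _ Xy] : naturals (X i w).
  by apply: contrapT => h; apply: nn; exists i.
exists y => //; rewrite ltnS leq_subRL; last by case/andP: kx.
rewrite addnC truncn_ge_nat// natrD Xy.
have := h1 _ ni; have : (Num.truncn K)%:R <= K by rewrite truncn_le.
by lra.
Qed.

(** The other variables are almost surely nonnegative. *)
Lemma first_jump_le x : (0 < n)%N ->
  (P (X 0%N @^-1` `]x, +oo[%classic) <= P [set w | (x < \sum_(i < n) X i w)%R])%E.
Proof.
move=> n0; apply: (prob_le_ae _ _ measurable_not_natural not_natural0).
- exact: measurable_preimage.
- rewrite (_ : [set w | _] = (fun w => \sum_(i < n) X i w) @^-1` `]x, +oo[%classic).
    exact: measurable_sum_gt.
  by apply/seteqP; split => w /=; rewrite in_itv/= andbT.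
move=> w /=; rewrite in_itv/= andbT => xw.
have [|nn] := pselect (not_natural w); first by right.
left; apply: (lt_le_trans xw).
have [m nm] : exists m, n = m.+1 by exists n.-1; lia.
rewrite nm big_ord_recl/= lerDl; apply: sumr_ge0 => i _.
have [y _ <-//] : naturals (X (bump 0 i) w).
apply: contrapT => h; apply: nn; exists (bump 0 i) => //=.
by have := ltn_ord i; rewrite /bump/= nm; lia.
Qed.

End SingleBigJump.

End TailFacts.

(** * Limits inferior, supports and tails *)

Section LimInfSup.
Variable R : realType.
Implicit Types (f : R -> \bar R) (a : \bar R).

Lemma limf_einf_ge f a : (\forall x \near +oo, (a <= f x)%E) ->
  (a <= limf_einf f (pinfty_nbhs R))%E.
Proof.
move=> h; rewrite limf_einfE.
apply: (@le_trans _ _ (ereal_inf (f @` [set x | (a <= f x)%E]))).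
  by apply: le_ereal_inf_tmp => _ [x ax <-].
by apply: ereal_sup_ubound; exists [set x | (a <= f x)%E].
Qed.

Lemma limf_esup_le f a : (\forall x \near +oo, (f x <= a)%E) ->
  (limf_esup f (pinfty_nbhs R) <= a)%E.
Proof.
move=> h; rewrite limf_esupE.
apply: (@le_trans _ _ (ereal_sup (f @` [set x | (f x <= a)%E]))).
  by apply: ereal_inf_lbound; exists [set x | (f x <= a)%E].
by apply: ge_ereal_sup => _ [x ax <-].
Qed.

Lemma limf_einf_gt f a : (a < limf_einf f (pinfty_nbhs R))%E ->
  \forall x \near +oo, (a < f x)%E.
Proof.
rewrite limf_einfE => /ereal_sup_gtP[_ [V hV <-] aV].
apply: filterS hV => x Vx; apply: (lt_le_trans aV).
by apply: ereal_inf_lbound; exists x.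
Qed.

Lemma limf_esup_lt f a : (limf_esup f (pinfty_nbhs R) < a)%E ->
  \forall x \near +oo, (f x < a)%E.
Proof.
rewrite limf_esupE => /ereal_inf_ltP[_ [V hV <-] aV].
apply: filterS hV => x Vx; apply: (le_lt_trans _ aV).
by apply: ereal_sup_ubound; exists x.
Qed.

(** Any two sets of the filter meet. *)
Lemma limf_einf_le_esup f :
  (limf_einf f (pinfty_nbhs R) <= limf_esup f (pinfty_nbhs R))%E.
Proof.
rewrite limf_einfE limf_esupE; apply: ge_ereal_sup => _ [V hV <-].
apply: le_ereal_inf_tmp => _ [W hW <-].
have [x [Vx Wx]] := filter_ex (filterI hV hW).
by apply: (@le_trans _ _ (f x)); [apply: ereal_inf_lbound|apply: ereal_sup_ubound]; exists x.
Qed.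

End LimInfSup.

Section Supports.
Variable R : realType.
Implicit Types F : probability R R.

(** Intervals with rational endpoints form a countable base, and those that are null
    cover the complement of the support. *)
Lemma support_conull F : F.-negligible (~` Defs.support F).
Proof.
pose W (q : rat * rat) : set R := let I := `]ratr q.1, ratr q.2[%classic in
  if F I == 0%E then I else set0.
pose V k : set R := if @choice.unpickle (rat * rat)%type k is Some q then W q else set0.
apply: (@negligibleS _ _ _ _ (\bigcup_k V k)); last first.
  apply: negligible_bigcup => k; rewrite /V; case: (@choice.unpickle _ k) => [q|]; last exact: negligible_set0.
  rewrite /W; case: ifP => [/eqP h|_]; last exact: negligible_set0.
  by apply/negligibleP => //; exact: measurable_itv.
move=> x /= /existsNP[U] /not_implyP[oU] /not_implyP[Ux] /negP.
rewrite -leNgt measure_le0 => /eqP FU.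
have [e /= e0 eU] : nbhs x U by exact: open_nbhs_nbhs.
have [a] := @rat_in_itvoo _ (x - e) x ltac:(lra); rewrite in_itv/= => /andP[xa ax].
have [b] := @rat_in_itvoo _ x (x + e) ltac:(lra); rewrite in_itv/= => /andP[xb bx].
have VW q : V (choice.pickle q) = W q by rewrite /V choice.pickleK.
exists (choice.pickle (a, b)); first by [].
rewrite VW /W ifT; first by rewrite /= in_itv/= ax xb.
rewrite -measure_le0 -FU; apply: le_measure; rewrite ?inE//.
  exact: open_measurable.
move=> y /=; rewrite in_itv/= => /andP[ay yb]; apply: eU; rewrite /ball/=.
rewrite ltr_norml; lra.
Qed.

Lemma support_null F A : measurable A -> A `<=` ~` Defs.support F -> F A = 0%E.
Proof.
by move=> mA /negligibleS/(_ (support_conull F)) /negligibleP; apply.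
Qed.

Lemma udist_neg0 (F : udist R) : law F `]-oo, 0[%classic = 0%E.
Proof.
apply: support_null => // x /=; rewrite in_itv/= => x0 /support_ge0/=.
by rewrite in_itv/= andbT leNgt x0.
Qed.

(** A null half-line ]x, +oo[ would bound the support by x. *)
Lemma udist_tail_gt0 (F : udist R) x : 0 < tail F x.
Proof.
rewrite lt_def; apply/andP; split; last by rewrite -lee_fin -tailE.
apply/eqP => t0; apply: (@support_unbounded _ F); exists x => y Fy.
rewrite leNgt; apply/negP => xy.
have : (0 < F `]x, +oo[%classic)%E.
  by apply: Fy; [exact: interval_open|rewrite /= in_itv/= andbT].
by rewrite tailE t0 ltxx.
Qed.

Lemma tail_noninc_real F x y : x <= y -> tail F y <= tail F x.
Proof.
move=> xy; rewrite -lee_fin -!tailE; apply: le_measure; rewrite ?inE//.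
by move=> z /=; rewrite !in_itv/= !andbT; apply: le_lt_trans.
Qed.

Lemma tail_cvg0 F : tail F x @[x --> +oo] --> 0.
Proof.
apply/cvgrPdist_lt => e e0.
have [n hn] : exists n : nat, tail F n%:R < e.
  have : F `]n%:R, +oo[%classic @[n --> \oo] --> F (\bigcap_n `]n%:R, +oo[%classic).
    apply: nonincreasing_cvg_mu => //.
    - by rewrite (le_lt_trans (probability_le1 _ _)) ?ltry.
    - by apply: bigcap_measurableType.
    - move=> m n mn; apply/subsetPset => z /=; rewrite !in_itv/= !andbT.
      by apply: le_lt_trans; rewrite ler_nat.
  have -> : \bigcap_n `]n%:R, +oo[%classic = set0 :> set R.
    rewrite -subset0 => z /(_ (Num.truncn z).+1 I)/=.
    by rewrite in_itv/= andbT ltNge ltW// truncnS_gt.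
  rewrite measure0 => /fine_cvgP[_] /cvgrPdist_lt/(_ e e0)[n _ /(_ n)/= hn].
  exists n; have := hn (leqnn _); rewrite sub0r normrN.
  by rewrite tailE/=; apply: le_lt_trans; exact: ler_norm.
exists n%:R; split; first exact: num_real.
move=> x nx; rewrite sub0r normrN ger0_norm -?lee_fin -?tailE//.
by apply: le_lt_trans hn; apply: tail_noninc_real; exact: ltW.
Qed.

End Supports.

(** * Lattice laws in J *)

Section LatticeClasses.
Variable R : realType.

(** The entry 0 of the decreasing sort is the maximum. *)
Lemma order_stat_gt (T : Type) (X : nat -> T -> R) n w c : (0 < n)%N ->
  order_stat X n 1 w > c <-> exists2 i, (i < n)%N & c < X i w.
Proof.
move=> n0; rewrite /order_stat; set l := sort _ _.
have lE : l =i [seq X i w | i <- iota 0 n] by move=> z; rewrite mem_sort.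
have ls : sorted >=%R l by apply: sort_sorted => a b; exact: le_total.
have lsz : size l = n by rewrite size_sort size_map size_iota.
case: l lE ls lsz => [|y l] lE ls lsz; first by move: n0; rewrite -lsz.
rewrite /=; split => [cy|[i ni ci]].
  have : y \in y :: l by rewrite mem_head.
  by rewrite lE => /mapP[i]; rewrite mem_iota => /andP[_ ni] yE; exists i => //; rewrite -yE.
have : X i w \in y :: l.
  by rewrite lE; apply: map_f; rewrite mem_iota.
rewrite inE => /orP[/eqP <- //|il]; apply: (lt_le_trans ci).
have /allP/(_ _ il) // : all (>=%R y) l.
  by apply: order_path_min ls => a b c' ab bc; exact: le_trans bc ab.
Qed.

(** All the mass is on the naturals, and every tail is positive. *)
Lemma exists_lattice_udist (s : nat -> R) : regular_root s ->
  exists F : udist R, lattice_law s F.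
Proof.
move=> hs; have [P [hT hN]] := exists_lattice_law hs.
have sup0 : Defs.support P `<=` `[0, +oo[%classic.
  move=> x Px /=; rewrite in_itv/= andbT leNgt; apply/negP => x0.
  have := Px `]-oo, 0[%classic (@interval_open _ _ _ _ _) .
  rewrite /= in_itv/= x0 => /(_ isT isT isT); rewrite lt_def measure_ge0 andbT.
  move=> /negP; apply; rewrite -measure_le0 -hN; apply: le_measure; rewrite ?inE//.
    by apply: measurableC; exact: measurable_naturals.
  by move=> z /=; rewrite in_itv/= => z0 [n _ nz]; move: z0; rewrite -nz ltrn0.
have supU : ~ has_ubound (Defs.support P).
  move=> [M hM]; have : P `]M, +oo[%classic = 0%E.
    apply: support_null => // x /=; rewrite in_itv/= andbT => Mx /hM.
    by rewrite leNgt Mx.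
  by rewrite tailE hT => -[] /eqP; rewrite gt_eqF//; exact: tail_gt0.
by exists (UDist sup0 supU).
Qed.

Lemma near1_fin (e : R) (y : \bar R) : ((1 - e)%:E <= y <= 1%:E)%E ->
  y \is a fin_num /\ `|1 - fine y| <= e.
Proof.
case: y => [r| |] /andP[]; rewrite ?lee_fin// => h1 h2.
by split => //=; rewrite ger0_norm ?subr_ge0//; lra.
Qed.

Section OneLaw.
Variables (s : nat -> R) (F : udist R).
Hypotheses (hs : regular_root s) (hF : lattice_law s F).

(** The failure event has probability at most e * P(X_0 > x), and P(X_0 > x) is a lower
    bound for P(S_n > x). *)
Lemma lattice_class_J : class_J R F.
Proof.
move=> d T P X [ind dist] n n2.
have mX i : measurable_fun setT (X i) by exact: measurable_funP.
have cylP ys : (size ys <= n)%N ->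
    (P (cylinder X ys) <= (\prod_(y <- ys) atom s y)%:E)%E.
  move=> _; pose B i : set R := [set (nth 0%N ys i)%:R].
  have := ind [fset i in iota 0 (size ys)]%fset B (fun i => measurable_set1 _).
  rewrite (_ : \bigcap_(i in _) _ = cylinder X ys); last first.
    apply/seteqP; split => w h i /=.
      by move=> isz; apply: h; rewrite /= !inE mem_iota.
    by rewrite !inE mem_iota => /andP[_ ?]; apply: h.
  move=> ->; rewrite (perm_big (iota 0 (size ys)))/=; last first.
    by apply: uniq_perm; rewrite ?fset_uniq ?iota_uniq// => i; rewrite !inE.
  have PB i : P (X i @^-1` B i) = (fine (F (B i)))%:E.
    rewrite fineK ?fin_num_measure//; last exact: measurable_set1.
    by apply: (dist i (B i)); exact: measurable_set1.
  rewrite (eq_bigr _ (fun i _ => PB i)) prodEFin lee_fin.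
  rewrite [leRHS](big_nth 0%N) -[X in iota 0 X]subn0 -/(index_iota _ _) !big_mkord.
  apply: ler_prod => i _; rewrite fine_ge0//= -lee_fin fineK; last first.
    by rewrite fin_num_measure//; exact: measurable_set1.
  exact: lattice_atom.
have natP i : (i < n)%N -> P (X i @^-1` (~` @naturals R)) = 0%E.
  move=> _; have [_ <-] := hF; apply: (dist i).
  by apply: measurableC; exact: measurable_naturals.
have n0 : (0 < n)%N by lia.
have morder y : measurable [set w | order_stat X n 1 w > y].
  rewrite (_ : [set w | _] = \bigcup_(i in `I_n) X i @^-1` `]y, +oo[%classic).
    by apply: bigcup_measurable => i _; apply: (measurable_preimage mX).
  apply/seteqP; split => w /=.
    by move=> /(order_stat_gt _ _ _ n0)[i ni h]; exists i => //=; rewrite in_itv/= andbT.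
  by move=> [i ni /=]; rewrite in_itv/= andbT => h; apply/(order_stat_gt _ _ _ n0); exists i.
have msum x : measurable [set w | \sum_(i < n) X i w > x].
  rewrite (_ : [set w | _] = (fun w => \sum_(i < n) X i w) @^-1` `]x, +oo[%classic).
    exact: (measurable_sum_gt mX).
  by apply/seteqP; split => w /=; rewrite in_itv/= andbT.
have jump e : 0 < e -> exists2 k0 : R, 0 < k0 & forall K x, k0 <= K -> K <= x ->
    1 - e <= cond_prob P [set w | order_stat X n 1 w > x - K]
                         [set w | \sum_(i < n) X i w > x].
  move=> e0; have [k0 k00 hk0] := no_big_jump_event hs mX cylP natP e0.
  exists k0 => // K x kK Kx; have := hk0 K x kK Kx; rewrite /cond_prob.
  have := first_jump_le mX natP x n0.
  set A := [set w | order_stat _ _ _ _ > _]; set B := [set w | _ < \sum_(_ < _) _].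
  set Z := [set w | _ /\ _].
  have mA : measurable A by exact: morder.
  have mB : measurable B by exact: msum.
  have -> : Z = B `\` A.
    apply/seteqP; split => w /=.
      move=> [h1 h2]; split => // /(order_stat_gt _ _ _ n0)[i ni].
      by rewrite ltNge h1.
    move=> [h1 h2]; split => // i ni; rewrite leNgt; apply/negP => h.
    by apply: h2; apply/(order_stat_gt _ _ _ n0); exists i.
  have := dist 0%N `]x, +oo[%classic (measurable_itv _).
  rewrite /distribution/= /pushforward => ->; rewrite tailE.
  have [hT _] := hF; rewrite -hT => h1 h2.
  have : P B = (P (B `\` A) + P (A `&` B))%E by rewrite (measureDI P mB mA) setIC.
  move: h1 h2; have tx := udist_tail_gt0 F x.
  rewrite -(fineK (fin_num_measure P _ mB)).
  rewrite -(fineK (fin_num_measure P _ (measurableD mB mA))).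
  rewrite -(fineK (fin_num_measure P _ (measurableI _ _ mA mB))).
  rewrite -EFinD => h1 h2 [h3]; move: h1 h2 h3; rewrite !lee_fin/=.
  move: (fine _) (fine _) (fine _) => pB pD pI h1 h2 h3.
  by rewrite ler_pdivlMr; nra.
have bound e : 0 < e -> exists2 k0 : R, 0 < k0 & forall K, k0 <= K ->
   ((1 - e)%:E <= limf_einf (fun x : R =>
      (cond_prob P [set w | order_stat X n 1 w > x - K]
                   [set w | \sum_(i < n) X i w > x])%:E) (pinfty_nbhs R) <= 1%:E)%E.
  move=> /jump[k0 k00 hk0]; exists k0 => // K kK; apply/andP; split.
    apply: limf_einf_ge; exists K; split; first exact: num_real.
    by move=> x Kx; rewrite lee_fin hk0// ltW.
  apply: le_trans (limf_einf_le_esup _) _; apply: limf_esup_le.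
  apply: nearW => x; rewrite lee_fin /cond_prob.
  set A := [set w | order_stat _ _ _ _ > _]; set B := [set w | _ < \sum_(_ < _) _].
  have mA : measurable A by exact: morder.
  have mB : measurable B by exact: msum.
  have [->|B0] := eqVneq (fine (P B)) 0; first by rewrite invr0 mulr0.
  rewrite ler_pdivrMr ?lt_def ?B0 ?fine_ge0// mul1r fine_le ?fin_num_measure//.
  - exact: measurableI.
  - by apply: le_measure; rewrite ?inE//; exact: measurableI.
apply/fine_cvgP; split.
  have [k0 k00 hk0] := bound 1 ltr01.
  exists k0; split; first exact: num_real.
  by move=> K /ltW/hk0/near1_fin[].
apply/cvgrPdist_le => e e0; have [k0 k00 hk0] := bound e e0.
exists k0; split; first exact: num_real.
by move=> K /ltW/hk0/near1_fin[].
Qed.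

End OneLaw.
End LatticeClasses.

(** * Convolution tails and subexponential lattice laws *)

Section Convolution.
Variable R : realType.

Lemma dfunE (F : probability R R) x : F `]-oo, x]%classic = (1 - tail F x)%:E.
Proof.
by rewrite /tail opprB addrC subrK /dfun fineK// fin_num_measure.
Qed.

Lemma itv_tailE (F : probability R R) t x : t <= x ->
  F `]t, x]%classic = (tail F t - tail F x)%:E.
Proof.
move=> tx; have : F `]t, +oo[%classic = (F `]t, x]%classic + F `]x, +oo[%classic)%E.
  rewrite -measureU//; last first.
    apply/seteqP; split => // z /= []; rewrite !in_itv/= andbT => /andP[_].
    by rewrite leNgt => /negP.
  congr (F _); apply/seteqP; split => z /=; rewrite !in_itv/= !andbT.
    by move=> tz; case: (leP z x) => zx; [left; rewrite tz|right].
  by move=> [/andP[]//|]; exact: le_lt_trans.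
rewrite !tailE -(fineK (fin_num_measure F _ (measurable_itv `]t, x]))) -EFinD.
by move=> [->]; rewrite addrK.
Qed.

Lemma conv_tailE (F : probability R R) x :
  (tail (convolution F F) x)%:E = (F \x F)%E [set z | x < z.1 + z.2].
Proof.
rewrite -tailE /convolution /distribution/= /pushforward; congr ((F \x F)%E _).
by apply/seteqP; split => z /=; rewrite in_itv/= andbT /Defs.add_pair.
Qed.

Lemma measurable_sum_pair (x : R) : measurable [set z : R * R | x < z.1 + z.2].
Proof.
have : measurable (@Defs.add_pair R @^-1` `]x, +oo[%classic).
  by rewrite -[X in measurable X]setTI; apply: Defs.measurable_add_pair.
congr measurable.
by apply/seteqP; split => z /=; rewrite in_itv/= andbT /Defs.add_pair.
Qed.

(** Three disjoint boxes in the event a + b > x: b > x; a > x and b <= t; a > x - t and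
    t < b <= x. *)
Lemma conv_tail_ge (F : udist R) (t x : R) : 0 <= t -> t <= x ->
  tail F x + (1 - tail F t) * tail F x + (tail F t - tail F x) * tail F (x - t)
  <= tail (convolution F F) x.
Proof.
move=> t0 tx; rewrite -lee_fin conv_tailE.
pose I1 : set R := `]x, +oo[%classic.
pose I2 : set R := `]-oo, t]%classic.
pose I3 : set R := `]x - t, +oo[%classic.
pose I4 : set R := `]t, x]%classic.
pose A : set (R * R) := setT `*` I1.
pose B : set (R * R) := I1 `*` I2.
pose C : set (R * R) := I3 `*` I4.
pose neg : set R := `]-oo, 0[%classic.
have mneg : measurable neg by exact: measurable_itv.
pose Z : set (R * R) := (neg `*` setT) `|` (setT `*` neg).
have mI1 : measurable I1 by exact: measurable_itv.
have mI2 : measurable I2 by exact: measurable_itv.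
have mI3 : measurable I3 by exact: measurable_itv.
have mI4 : measurable I4 by exact: measurable_itv.
have mA : measurable A by apply: measurableX.
have mB : measurable B by apply: measurableX.
have mC : measurable C by apply: measurableX.
have mZ : measurable Z by apply: measurableU; apply: measurableX.
have Z0 : (F \x F)%E Z = 0%E.
  have : ((F \x F) Z <= (F \x F) (neg `*` setT) + (F \x F) (setT `*` neg))%E.
    by apply: measureU2; apply: measurableX.
  have n0 : F neg = 0%E := udist_neg0 F.
  by rewrite !product_measure1E//= n0 mule0 mul0e adde0 measure_le0 => /eqP.
have -> : (tail F x + (1 - tail F t) * tail F x +
    (tail F t - tail F x) * tail F (x - t))%:E = (F \x F)%E (A `|` B `|` C).
  rewrite measureU//; last 2 first.
  - exact: measurableU.
  - apply/seteqP; split => // z /= [[]]; rewrite /A /B /C /I1 /I2 /I3 /I4/= !in_itv/= ?andbT.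
      by move=> [_ h1] [_ /andP[_]]; rewrite leNgt h1.
    by move=> [_ h1] [_ /andP[]]; rewrite ltNge h1.
  rewrite measureU//; last first.
    apply/seteqP; split => // z /= []; rewrite /A /B /I1 /I2/= !in_itv/= ?andbT.
    by move=> [_ h1] [_]; rewrite leNgt (le_lt_trans tx h1).
  rewrite /= /A /B /C !product_measure1E//= probability_setT mul1e.
  rewrite (tailE F x : F I1 = _) (dfunE F t : F I2 = _) (tailE F (x - t) : F I3 = _).
  by rewrite (itv_tailE F tx : F I4 = _) -!EFinM -!EFinD; congr (_%:E); ring.
apply: (prob_le_ae _ _ mZ Z0).
- by apply: measurableU => //; exact: measurableU.
- exact: measurable_sum_pair.
move=> [a b]; rewrite /A /B /C /I1 /I2 /I3 /I4 /Z /neg/= !in_itv/= !andbT => h.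
have [b0|b0] := ltP b 0; first by right; right.
have [a0|a0] := ltP a 0; first by right; left.
left; case: h => [[[_ h]|[h1 h2]]|[h1 /andP[h2 h3]]]; lra.
Qed.

(** By [conv_tail_ge] the ratio of the tail of F * F to the tail of F, which tends to 2, is
    at least 2 - tail t + (tail t - o(1)) * tail (x - t) / tail x.  So
    tail (x - t) / tail x is eventually below any number larger than 1. *)
Lemma class_S_tail_le (F : udist R) t : class_S R F -> 0 < t ->
  \forall x \near +oo, tail F (x - t) <= 2 * tail F x.
Proof.
move=> hS t0; have gt0 := udist_tail_gt0 F t.
have g4 : 0 < tail F t / 4 by rewrite divr_gt0.
move/cvgrPdist_lt: hS => /(_ _ g4) hS.
have := @tail_cvg0 _ F => /cvgrPdist_lt/(_ _ g4) h0.
near=> x.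
have tx : t <= x by near: x; apply: nbhs_pinfty_ge; exact: num_real.
have x0 := udist_tail_gt0 F x.
have h1 : tail F x < tail F t / 4.
  have : `|0 - tail F x| < tail F t / 4 by near: x.
  by rewrite sub0r normrN gtr0_norm.
have h2 : tail (convolution F F) x <= (2 + tail F t / 4) * tail F x.
  rewrite -ler_pdivrMr//.
  have : `|2 - tail (convolution F F) x / tail F x| < tail F t / 4 by near: x.
  by rewrite ltr_norml => /andP[h _]; lra.
have := conv_tail_ge F (ltW t0) tx; have := udist_tail_gt0 F (x - t).
move: (tail _ (x - t)) => y y0; nra.
Unshelve. all: by end_near.
Qed.

Section LatticeS.
Variables (s : nat -> R) (F : udist R).
Hypotheses (hs : regular_root s) (hF : lattice_law s F).
Hypothesis hlong : forall e, 0 < e -> exists n0, forall n, (n0 <= n)%N ->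
  s n ^+ 2 <= (1 + e) * s n.+1 ^+ 2.

Lemma long_tail_shift k e : 0 < e -> exists n0, forall n, (n0 <= n)%N ->
  s n ^+ 2 <= (1 + e) * s (n + k)%N ^+ 2.
Proof.
elim: k e => [|k IH] e e0.
  by exists 0%N => n _; rewrite addn0; have := tail_gt0 hs n; nra.
have e2 : 0 < e / 2 by rewrite divr_gt0.
have e3 : 0 < e / (2 + e) by rewrite divr_gt0// addr_gt0.
have [n0 h0] := IH _ e2; have [n1 h1] := hlong e3.
exists (maxn n0 n1) => n; rewrite geq_max => /andP[n0n n1n].
have := h0 n n0n; have := h1 (n + k)%N ltac:(lia); rewrite addnS.
have E : (1 + e / 2) * (1 + e / (2 + e)) = 1 + e by field; lra.
move=> a1 a2; rewrite -E -mulrA; apply: (le_trans a2).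
by rewrite ler_wpM2l// addr_ge0// ltW.
Qed.

Let X i (z : R * R) : R := if i is 0%N then z.1 else z.2.

(** Upper bound: either one of the two variables exceeds x - k, with k so large that the
    event of no big summand is negligible, and the tail at x - k is
    asymptotic to the tail at x.  Lower bound: [conv_tail_ge] at t = 0. *)
Lemma lattice_class_S : class_S R F.
Proof.
have [hT hN] := hF.
have mX i : measurable_fun setT (X i).
  by case: i => [|i]; [exact: measurable_fst|exact: measurable_snd].
pose P : probability (R * R)%type R := (F \x F)%E.
have PE A B : measurable A -> measurable B -> P (A `*` B) = (F A * F B)%E.
  by move=> mA mB; exact: product_measure1E.
have cylP ys : (size ys <= 2)%N ->
    (P (cylinder X ys) <= (\prod_(y <- ys) atom s y)%:E)%E.
  case: ys => [|a [|b [|//]]] _.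
  - by rewrite big_nil; apply: probability_le1; exact: (measurable_cylinder mX).
  - rewrite big_seq1 (_ : cylinder X [:: a] = [set a%:R] `*` setT); last first.
      apply/seteqP; split => z /=; first by move=> h; split => //; exact: (h 0%N erefl).
      by move=> [h _] [|//] _.
    rewrite PE// probability_setT mule1.
    exact: lattice_atom.
  - rewrite big_cons big_seq1.
    rewrite (_ : cylinder X [:: a; b] = [set a%:R] `*` [set b%:R]); last first.
      apply/seteqP; split => z /=.
        by move=> h; split; [exact: (h 0%N erefl)|exact: (h 1%N erefl)].
      by move=> [h h'] [|[|//]] _.
    rewrite PE// EFinM lee_pmul//; exact: lattice_atom.
have mN : measurable (~` @naturals R) by apply: measurableC; exact: measurable_naturals.
have natP i : (i < 2)%N -> P (X i @^-1` (~` @naturals R)) = 0%E.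
  case: i => [|i] _.
    rewrite (_ : _ @^-1` _ = (~` @naturals R) `*` setT).
      by rewrite PE// hN mul0e.
    by apply/seteqP; split => z //= [].
  rewrite (_ : _ @^-1` _ = setT `*` (~` @naturals R)).
    by rewrite PE// hN mule0.
  by apply/seteqP; split => z //= [].
have sumX z : \sum_(i < 2) X i z = z.1 + z.2 by rewrite 2!big_ord_recl big_ord0 addr0.
apply/cvgrPdist_le => e e0.
have e6 : 0 < e / 4 by rewrite divr_gt0.
have [K0 K00 hK] := no_big_jump_event hs mX cylP natP e6.
pose k := (Num.truncn K0).+1.
have kK : K0 <= k%:R by rewrite ltW// truncnS_gt.
have [n0 hn0] := long_tail_shift k e6.
have := @tail_cvg0 _ F => /cvgrPdist_lt/(_ _ e0) h0.
near=> x.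
have kx : k%:R <= x by near: x; apply: nbhs_pinfty_ge; exact: num_real.
have x0 : 0 <= x by apply: le_trans kx.
have n0x : n0%:R + k%:R <= x by near: x; apply: nbhs_pinfty_ge; exact: num_real.
have tx := udist_tail_gt0 F x.
have lower : tail F x * (2 - tail F x) <= tail (convolution F F) x.
  by have := conv_tail_ge F (lexx 0) x0; rewrite subr0; nra.
have small : tail F x < e.
  have : `|0 - tail F x| < e by near: x.
  by rewrite sub0r normrN gtr0_norm.
have shift : tail F (x - k%:R) <= (1 + e / 4) * tail F x.
  rewrite !hT; apply: le_trans (hn0 (Num.truncn (x - k%:R)) _) _.
    by rewrite truncn_ge_nat ?subr_ge0//; lra.
  rewrite ler_wpM2l ?addr_ge0// ?(ltW e6)//; apply: tail_noninc hs _ _ _.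
  rewrite -truncn_lt_real.
  have := truncnS_gt (x - k%:R); rewrite -addSn natrD; lra.
have upper : tail (convolution F F) x <= (2 + e) * tail F x.
  have := hK k%:R x kK kx; rewrite -hT.
  under eq_set do rewrite sumX.
  set Z := [set w | _ /\ _] => hZ.
  have mS := measurable_sum_pair x.
  pose A : set (R * R) := `]x - k%:R, +oo[%classic `*` setT.
  pose B : set (R * R) := setT `*` `]x - k%:R, +oo[%classic.
  have mA : measurable A by apply: measurableX.
  have mB : measurable B by apply: measurableX.
  have ZE : Z = [set z | x < z.1 + z.2] `\` (A `|` B).
    apply/seteqP; split => z; rewrite /Z /A /B/= !in_itv/= !andbT.
      move=> [h1 h2]; split => // -[[h _]|[_ h]].
        by have := h1 0%N isT; rewrite /X/= leNgt h.
      by have := h1 1%N isT; rewrite /X/= leNgt h.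
    move=> [h1 /not_orP[h2 h3]]; split => // -[|i] _ /=; rewrite leNgt; apply/negP => h.
      by apply: h2.
    by apply: h3.
  pose W : set (R * R) := [set z | x < z.1 + z.2].
  have PAB : (P (A `|` B) <= (tail F (x - k%:R) + tail F (x - k%:R))%:E)%E.
    rewrite EFinD -tailE; apply: le_trans (measureU2 P mA mB) _.
    by rewrite /= !PE//= probability_setT mule1 mul1e.
  have : (P W <= (tail F (x - k%:R) + tail F (x - k%:R) + e / 4 * tail F x)%:E)%E.
    have -> : P W = (P (W `&` (A `|` B)) + P Z)%E.
      by rewrite ZE addeC -measureDI//; exact: measurableU.
    rewrite EFinD; apply: leeD => //; apply: le_trans PAB; apply: le_measure.
    - by rewrite inE; apply: measurableI => //; exact: measurableU.
    - by rewrite inE; exact: measurableU.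
    - exact: subIsetr.
  have -> : P W = (tail (convolution F F) x)%:E by rewrite conv_tailE.
  by rewrite lee_fin; nra.
rewrite ler_norml; apply/andP; split.
  by rewrite lerBrDr -lerBrDl ler_pdivrMr//; lra.
by rewrite lerBlDr -lerBlDl ler_pdivlMr//; nra.
Unshelve. all: by end_near.
Qed.

End LatticeS.
End Convolution.

(** * The four examples *)

Section Assembly.
Variable R : realType.

Lemma limf_esup_lty_bound (f : R -> \bar R) : (limf_esup f (pinfty_nbhs R) < +oo)%E ->
  exists2 B : R, 0 < B & \forall x \near +oo, (f x <= B%:E)%E.
Proof.
move=> h; have [B B0 hB] : exists2 B : R, 0 < B & (limf_esup f (pinfty_nbhs R) < B%:E)%E.
  case: (limf_esup _ _) h => [r| |] // _; last by exists 1; rewrite ?ltNyr.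
  exists (`|r| + 1); first by rewrite ltr_wpDl.
  by rewrite lte_fin; have := ler_norm r; lra.
exists B => //; near=> x; apply: ltW; near: x; exact: limf_esup_lt.
Unshelve. all: by end_near.
Qed.

Lemma limf_einf_gt0_bound (f : R -> \bar R) : (0 < limf_einf f (pinfty_nbhs R))%E ->
  exists2 b : R, 0 < b & \forall x \near +oo, (b%:E <= f x)%E.
Proof.
move=> h; have [b b0 hb] : exists2 b : R, 0 < b & (b%:E < limf_einf f (pinfty_nbhs R))%E.
  case: (limf_einf _ _) h => [r| |] //; last by exists 1; rewrite ?ltry.
  by rewrite lte_fin => r0; exists (r / 2); rewrite ?divr_gt0// lte_fin; lra.
exists b => //; near=> x; apply: ltW; near: x; exact: limf_einf_gt.
Unshelve. all: by end_near.
Qed.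

Section OneExample.
Variables (N : nat -> nat) (M : nat -> nat -> nat).
Hypothesis hN : scales N M.
Let u := staircase R N M.
Let f n : R := (Num.truncn (u n))%:R.
Variable F : udist R.
Hypothesis hF : lattice_law (exp_decay f) F.

Let hf : height f. Proof. exact: truncn_height (staircase_height R hN). Qed.
Let hs : regular_root (exp_decay f). Proof. exact: exp_decay_regular hf. Qed.
Let u_ge0 n : 0 <= u n.
Proof. by have := staircase_mono R hN (leq0n n); rewrite staircase0. Qed.
Let f_le n : f n <= u n. Proof. by rewrite /f truncn_le. Qed.
Let f_gt n : u n < f n + 1. Proof. by rewrite /f natr1 truncnS_gt. Qed.

Let tailF x : tail F x = expR (- (2 * f (Num.truncn x))).
Proof. by have [-> _] := hF; rewrite exp_decay_sqr. Qed.

Let tailFn n : tail F n%:R = expR (- (2 * f n)).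
Proof. by rewrite tailF natrK. Qed.

Let ratio_ge m n : 1 + 2 * (f n - f m) <= tail F m%:R / tail F n%:R.
Proof.
rewrite !tailFn -expRN -expRD; apply: le_trans (expR_ge1Dx _) _.
by rewrite ler_expR; lra.
Qed.

(** The integral is at least exp (a n) P(X > n) for each n. *)
Lemma floor_staircase_class_K : class_K R F.
Proof.
move=> a a0; apply: eq_infty => A.
have [n hn] := staircase_sublinear hN A a0.
have mE : measurable_fun setT (fun y : R => (expR (a * y))%:E).
  apply/measurable_EFinP; apply: (@measurableT_comp _ _ _ _ _ _ (@expR R) setT ( *%R a)); first exact: measurable_expR.
  exact: mulrl_measurable.
apply: (@le_trans _ _ (\int[law F]_(y in `]n%:R, +oo[) (expR (a * y))%:E)%E); last first.
  apply: ge0_subset_integral => //.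
  - by apply: measurable_funTS.
  - move=> y /=; rewrite !in_itv/= !andbT => ny; apply: le_trans (ltW ny); exact: ler0n.
apply: (@le_trans _ _ (\int[law F]_(y in `]n%:R, +oo[) (cst (expR (a * n%:R))%:E y))%E).
  rewrite integral_cst//= tailE tailFn -EFinM lee_fin -expRD.
  apply: le_trans (expR_ge1Dx _); have := f_le n; rewrite -/u in hn; lra.
apply: ge0_le_integral => //.
- by move=> y _; rewrite lee_fin expR_ge0.
- by apply: measurable_funTS.
- move=> y /=; rewrite in_itv/= andbT => ny.
  by rewrite lee_fin ler_expR ler_wpM2l// ltW.
Qed.

(** Heights are integers, so a one-step ratio below exp 2 means no step at all; if the
    ratios tend to 1, the height is eventually constant, hence bounded. *)
Lemma floor_staircase_not_L : ~ class_L R F.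
Proof.
move=> /(_ 1 ltr01)/cvgrPdist_lt/(_ 1 ltr01)[A [_ hA]].
pose m := (Num.truncn A).+1.
have Am : A < m%:R by exact: truncnS_gt.
have step n : (m <= n)%N -> f n.+1 <= f n.
  move=> mn; have An : A < n.+1%:R.
    by apply: (lt_trans Am); rewrite ltr_nat.
  have := hA _ An; rewrite -[in X in tail F X](natr1 n) addrK ltr_norml => /andP[h _].
  rewrite leNgt; apply/negP => lt.
  have := ratio_ge n n.+1; have : f n + 1 <= f n.+1.
    by move: lt; rewrite /f ltr_nat natr1 ler_nat.
  lra.
have [n hn] := height_unbounded hf (f m).
have : (m <= n)%N.
  by rewrite leqNgt; apply/negP => nm; have := height_mono hf (ltnW nm); lra.
move=> mn; suff : f n <= f m by lra.
elim: n mn {hn} => [|n IH]; first by rewrite leqn0 => /eqP ->.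
rewrite leq_eqVlt => /orP[/eqP -> //|]; rewrite ltnS => mn.
exact: le_trans (step _ mn) (IH mn).
Qed.

(** The height gains at least k - 1 between N k and 2 N k. *)
Lemma floor_staircase_not_D : ~ class_D R F.
Proof.
move=> /limf_esup_lty_bound[B B0 [A [_ hA]]].
pose k := maxn (Num.truncn A).+1 (Num.truncn B).+2.
have Ak : A < k%:R.
  by apply: lt_le_trans (truncnS_gt _) _; rewrite ler_nat leq_maxl.
have Bk : B + 1 < k%:R.
  apply: (@lt_le_trans _ _ (Num.truncn B).+2%:R); last by rewrite ler_nat leq_maxr.
  by rewrite -natr1 ltrD2r truncnS_gt.
have ANk : A < (2 * N k)%N%:R.
  by apply: (lt_le_trans Ak); rewrite ler_nat; have := ltn_scale hN k; lia.
have := hA _ ANk; rewrite lee_fin.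
have -> : (2 * N k)%N%:R / 2 = (N k)%:R :> R by rewrite natrM; field.
have := ratio_ge (N k) (2 * N k)%N; have := staircase_block R hN k.
have := f_le (N k); have := f_gt (2 * N k)%N; rewrite -/u; lra.
Qed.

Lemma floor_staircase_class_A : class_A R F.
Proof.
split; first by split; [exact: lattice_class_J hs hF|exact: floor_staircase_class_K].
by case; [exact: floor_staircase_not_L|exact: floor_staircase_not_D].
Qed.

Lemma floor_staircase_DK1 :
  (forall n, (0 < n)%N -> 2 * u n <= ln n%:R) -> class_DK1 R F.
Proof.
move=> hu; exists 2 => //; apply/cvgryPge => A.
near=> x.
have x2 : 2 <= x by near: x; apply: nbhs_pinfty_ge; exact: num_real.
have Ax : A <= x by near: x; apply: nbhs_pinfty_ge; exact: num_real.
have nx : (Num.truncn x)%:R <= x by rewrite truncn_le; lra.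
have n0 : (0 < Num.truncn x)%N by rewrite truncn_gt0; lra.
rewrite tailF powR_mulrn; last lra.
have n0R : 0 < (Num.truncn x)%:R :> R by rewrite ltr0n.
have : (Num.truncn x)%:R^-1 <= expR (- (2 * f (Num.truncn x))).
  rewrite -[X in X^-1]lnK ?posrE// -expRN ler_expR.
  by have := hu _ n0; have := f_le (Num.truncn x); rewrite -/u; lra.
have : x^-1 <= (Num.truncn x)%:R^-1 by rewrite lef_pV2 ?posrE//; lra.
move: (expR _) (_%:R^-1) => E q h1 h2.
apply: (le_trans Ax); have xE : x^-1 <= E by apply: le_trans h1 h2.
have : x ^+ 2 * x^-1 <= x ^+ 2 * E by rewrite ler_wpM2l ?sqr_ge0.
by rewrite expr2 mulfK//; lra.
Unshelve. all: by end_near.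
Qed.

Lemma floor_staircase_not_DK1 :
  (forall d : R, exists B, forall k, d * ln (N k)%:R - 2 * u (N k) <= B) ->
  ~ class_DK1 R F.
Proof.
move=> hu [d d0 /cvgryPgt hd]; have [B hB] := hu d.
have [A [_ hA]] := hd (expR (B + 2)).
pose k := (Num.truncn A).+1.
have Ak : A < (N k)%:R.
  by apply: (lt_trans (truncnS_gt A)); rewrite ltr_nat; exact: ltn_scale hN k.
have := hA _ Ak; rewrite tailFn /powR gt_eqF ?ltr0n ?(scale_gt0 hN)// -expRD ltr_expR.
by have := hB k; have := f_gt (N k); lra.
Qed.

End OneExample.

(** The unrounded height defines the law in S, and rounding costs a factor between 1 and
    exp 2. *)
Lemma wide_floor_equiv_S N (F : udist R) : scales N (fun k i => N k) ->
  lattice_law (exp_decay (fun n =>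
    (Num.truncn (staircase R N (fun k i => N k) n))%:R)) F ->
  exists2 G : udist R, class_S R G & weakly_tail_equivalent F G.
Proof.
move=> hN [hF _]; set u := staircase R N _ in hF.
have hu : regular_root (exp_decay u).
  exact: exp_decay_regular (staircase_height R hN).
have [G hG] := exists_lattice_udist hu; exists G.
  apply: (lattice_class_S hu hG) => e e0.
  have d0 : 0 < ln (1 + e) / 2.
    by rewrite divr_gt0// ln_gt0// ltrDl.
  have [n0 hn0] := wide_staircase_step hN d0; exists n0 => n /hn0; rewrite -/u => step.
  rewrite !exp_decay_sqr -[1 + e]lnK ?posrE ?addr_gt0// -expRD ler_expR; lra.
have bound x : 1 <= tail F x / tail G x <= expR 2.
  have [-> _] := hG; rewrite hF !exp_decay_sqr -expRN -expRD.
  set m := Num.truncn x.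
  have u0 : 0 <= u m by have := staircase_mono R hN (leq0n m); rewrite staircase0.
  have lo : (Num.truncn (u m))%:R <= u m by rewrite truncn_le.
  have hi : u m < (Num.truncn (u m))%:R + 1 by rewrite natr1 truncnS_gt.
  rewrite ler_expR -[leLHS]expR0 ler_expR; apply/andP; split; lra.
split; last 2 first.
- exact: limf_einf_le_esup.
- apply: (@le_lt_trans _ _ (expR 2)%:E); last exact: ltry.
  by apply: limf_esup_le; apply: nearW => x; rewrite lee_fin; case/andP: (bound x).
- apply: (@lt_le_trans _ _ 1%:E); first by rewrite lte_fin.
  by apply: limf_einf_ge; apply: nearW => x; rewrite lee_fin; case/andP: (bound x).
Qed.

(** If b G <= F <= B G for the tails, with G in S, then [class_S_tail_le] bounds
    F (x - t) / F x by 2 B / b for large x, whatever t is.  For t = N a and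
    x = N k + N a that ratio is at least exp (2 (a - 1)). *)
Lemma narrow_floor_not_equiv_S N (F : udist R) : scales N (fun k i => N i) ->
  lattice_law (exp_decay (fun n =>
    (Num.truncn (staircase R N (fun k i => N i) n))%:R)) F ->
  ~ exists2 G : udist R, class_S R G & weakly_tail_equivalent F G.
Proof.
move=> hN [hF _] [G hG [/limf_einf_gt0_bound[b b0 hb] _ /limf_esup_lty_bound[B B0 hB]]].
set u := staircase R N _ in hF.
pose a := (Num.truncn (2 * B / b)).+1.
have Na : 0 < (N a)%:R :> R by rewrite ltr0n (scale_gt0 hN).
have [A1 [_ h1]] := hb; have [A2 [_ h2]] := hB.
have [A3 [_ h3]] := class_S_tail_le hG Na.
pose k := maxn a (maxn (Num.truncn A1).+1 (maxn (Num.truncn A2).+1 (Num.truncn A3).+1)).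
have ak : (a <= k)%N by exact: leq_maxl.
have Nk A : ((Num.truncn A).+1 <= k)%N -> A < (N k)%:R :> R.
  move=> Ak; apply: (lt_le_trans (truncnS_gt A)); rewrite ler_nat.
  by apply: (leq_trans Ak); exact: ltnW (ltn_scale hN k).
have A1k : A1 < (N k)%:R by apply: Nk; rewrite /k; lia.
have A2k : A2 < (N k)%:R by apply: Nk; rewrite /k; lia.
have A3k : A3 < (N k)%:R by apply: Nk; rewrite /k; lia.
have e1 := h1 ((N k + N a)%N%:R) ltac:(rewrite natrD; lra).
have e3 := h3 ((N k + N a)%N%:R) ltac:(rewrite natrD; lra).
have e2 := h2 (N k)%:R A2k.
move: e1 e2 e3; rewrite natrD addrK -natrD !lee_fin.
have G1 := udist_tail_gt0 G (N k)%:R; have G2 := udist_tail_gt0 G (N k + N a)%N%:R.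
rewrite ler_pdivlMr// ler_pdivrMr// => e1 e2 e3.
have F2 := udist_tail_gt0 F (N k + N a)%N%:R.
have drop : (2 * a%:R - 1) * tail F (N k + N a)%N%:R <= tail F (N k)%:R.
  rewrite -ler_pdivlMr// !hF !natrK !exp_decay_sqr -expRN -expRD.
  apply: le_trans (expR_ge1Dx _).
  have u0 n : 0 <= u n by have := staircase_mono R hN (leq0n n); rewrite staircase0.
  have lo : (Num.truncn (u (N k)))%:R <= u (N k) by rewrite truncn_le.
  have hi : u (N k + N a)%N < (Num.truncn (u (N k + N a)%N))%:R + 1.
    by rewrite natr1 truncnS_gt.
  have := narrow_staircase_drop R hN ak; rewrite -/u; lra.
have aB : 2 * B < a%:R * b.
  by rewrite -ltr_pdivrMr//; exact: truncnS_gt.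
have a1 : 1 <= a%:R :> R by rewrite ler1n.
have c1 : tail F (N k)%:R <= 2 * B * tail G (N k + N a)%N%:R.
  by have := ler_wpM2l (ltW B0) e3; lra.
have c2 : b * tail F (N k)%:R <= 2 * B * tail F (N k + N a)%N%:R.
  by have := ler_wpM2l (ltW b0) c1; have := ler_wpM2l (ltW B0) e1; lra.
have c3 : b * ((2 * a%:R - 1) * tail F (N k + N a)%N%:R) <= 2 * B * tail F (N k + N a)%N%:R.
  by apply: le_trans c2; rewrite ler_wpM2l// ltW.
move: c3; rewrite mulrA ler_pM2r//; nra.
Qed.

Definition geometric_scale (k : nat) : nat := (8 ^ k.+1)%N.
Definition sparse_scale (k : nat) : nat := (8 ^ (k.+1 ^ 2))%N.

Lemma geometric_scale_gt0 : (0 < geometric_scale 0)%N.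
Proof. by rewrite expn_gt0. Qed.

Lemma geometric_scaleS k : (8 * geometric_scale k <= geometric_scale k.+1)%N.
Proof. by rewrite -expnS. Qed.

Lemma sparse_scale_gt0 : (0 < sparse_scale 0)%N.
Proof. by rewrite expn_gt0. Qed.

Lemma sparse_scaleS k : (8 * sparse_scale k <= sparse_scale k.+1)%N.
Proof. by rewrite -expnS leq_exp2l// ltn_sqr. Qed.

Lemma geometric_floor_A_not_DK1 M (F : udist R) : scales geometric_scale M ->
  lattice_law (exp_decay (fun n =>
    (Num.truncn (staircase R geometric_scale M n))%:R)) F ->
  (class_A R `\` class_DK1 R) F.
Proof.
move=> hN hF; split; first exact (floor_staircase_class_A hN hF).
apply: (floor_staircase_not_DK1 hN hF) => d; exact: geometric_staircase_light.
Qed.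

Lemma sparse_floor_A_DK1 M (F : udist R) : scales sparse_scale M ->
  lattice_law (exp_decay (fun n =>
    (Num.truncn (staircase R sparse_scale M n))%:R)) F ->
  (class_A R `&` class_DK1 R) F.
Proof.
move=> hN hF; split; first exact (floor_staircase_class_A hN hF).
apply: (floor_staircase_DK1 hN hF) => n n0; exact: sparse_staircase_heavy.
Qed.

Lemma exists_floor_staircase_law N M : scales N M ->
  exists F : udist R, lattice_law (exp_decay (fun n =>
    (Num.truncn (staircase R N M n))%:R)) F.
Proof.
move=> hN; apply: exists_lattice_udist; apply: exp_decay_regular.
exact: truncn_height (staircase_height R hN).
Qed.

End Assembly.

Local Close Scope ring_scope.

Theorem theorem1p2 (R : realType) :
  (class_A R !=set0) /\
  (class_A R `&` class_DK1 R !=set0) /\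
  (class_A R `\` class_DK1 R !=set0) /\
  (exists2 F : udist R, (class_A R `&` class_DK1 R) F &
     exists2 G : udist R, class_S R G & weakly_tail_equivalent F G) /\
  (exists2 F : udist R, (class_A R `&` class_DK1 R) F &
     ~ exists2 G : udist R, class_S R G & weakly_tail_equivalent F G) /\
  (exists2 F : udist R, (class_A R `\` class_DK1 R) F &
     exists2 G : udist R, class_S R G & weakly_tail_equivalent F G) /\
  (exists2 F : udist R, (class_A R `\` class_DK1 R) F &
     ~ exists2 G : udist R, class_S R G & weakly_tail_equivalent F G).
Proof.
have sw := wide_scales sparse_scale_gt0 sparse_scaleS.
have sn := narrow_scales sparse_scale_gt0 sparse_scaleS.
have gw := wide_scales geometric_scale_gt0 geometric_scaleS.
have gn := narrow_scales geometric_scale_gt0 geometric_scaleS.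
have [F1 hF1] := exists_floor_staircase_law R sw.
have [F2 hF2] := exists_floor_staircase_law R sn.
have [F3 hF3] := exists_floor_staircase_law R gw.
have [F4 hF4] := exists_floor_staircase_law R gn.
have A1 := sparse_floor_A_DK1 sw hF1; have A2 := sparse_floor_A_DK1 sn hF2.
have A3 := geometric_floor_A_not_DK1 gw hF3.
have A4 := geometric_floor_A_not_DK1 gn hF4.
split; first by exists F1; case: A1.
split; first by exists F1.
split; first by exists F3.
split; first by exists F1 => //; exact: wide_floor_equiv_S sw hF1.
split; first by exists F2 => //; exact: narrow_floor_not_equiv_S sn hF2.
split; first by exists F3 => //; exact: wide_floor_equiv_S gw hF3.
by exists F4 => //; exact: narrow_floor_not_equiv_S gn hF4.
Qed.
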